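(* Let $\Omega$ be a countably infinite set, let $\gamma_{i\to j}\ge0$ ($i,j\in\Omega$, $\gamma_{i\to i}=0$) be transition rates, let $\Gamma$ be the associated generator, and assume $\sum_{i,j\in\Omega}|\Gamma^{(i,j)}|<\infty$. If the master equation $\dot P=\Gamma P$ is both irreducible and positive recurrent, then the limit $\lim_{t\to\infty}e^{t\Gamma}X_0$ exists with respect to $\|\cdot\|_1$ for all $X_0\in\ell^1(\Omega)$.
   Context: $\ell^1(\Omega)$ is the space of real absolutely summable families with norm $\|X\|_1=\sum_{\omega\in\Omega}|X^{(\omega)}|$. Generator: $\Gamma^{(i,j)}=\gamma_{j\to i}$ for $i\ne j$ and $\Gamma^{(j,j)}=-\sum_{k\in\Omega}\gamma_{j\to k}$; it acts on $\ell^1(\Omega)$ by $(\Gamma X)^{(i)}=\sum_j\Gamma^{(i,j)}X^{(j)}$, and $e^{t\Gamma}=\sum_{k\ge0}(t\Gamma)^k/k!$. The master equation is irreducible if the directed graph on $\Omega$ with a link $i\to j$ whenever $\gamma_{i\to j}>0$ is strongly connected. It is positive recurrent if the continuous-time Markov chain $(X_t)_{t\ge0}$ on $\Omega$ with transition probabilities $\mathbb P(X_t=i\mid X_0=j)=(e^{t\Gamma})^{(i,j)}$ has the property that, for every initial state $X_0=\omega_0$, the return time $t_R=\inf\{t>0:X_t=\omega_0\text{ and }X_\tau\ne\omega_0\text{ for some }\tau\in(0,t)\}$ is almost surely finite and has finite expectation. *)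

(* Defs.v *)
From HB Require Import structures.
From mathcomp Require Import all_boot all_order all_algebra.
From mathcomp Require Import all_classical all_reals all_analysis.

Set Implicit Arguments.
Unset Strict Implicit.
Unset Printing Implicit Defensive.
Import Order.TTheory GRing.Theory Num.Theory.
Import numFieldNormedType.Exports.
Local Open Scope classical_set_scope.
Local Open Scope ring_scope.

Section L1.
Variables (R : realType) (Omega : choiceType).

Definition l1norm (X : Omega -> R) : \bar R :=
  (\esum_(i in [set: Omega]) `|X i|%:E)%E.

Definition in_l1 (X : Omega -> R) : Prop := (l1norm X < +oo)%E.

(* Unordered sum of a real family (positive part minus negative part); it is
   meaningful for absolutely summable families only. *)
Definition usum (f : Omega -> R) : R :=
  fine (\esum_(i in [set: Omega]) (f^\+ i)%:E)
  - fine (\esum_(i in [set: Omega]) (f^\- i)%:E).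

Definition mxapp (A : Omega -> Omega -> R) (X : Omega -> R) : Omega -> R :=
  fun i => usum (fun j => A i j * X j).

(* (e^{tA} X)^{(i)} = sum_k ((tA)^k X)^{(i)} / k!.  When A is absolutely
   summable it is bounded on l^1, so that the operator series converges in
   operator norm and its coordinates are the limits below. *)
Definition expapp (A : Omega -> Omega -> R) (t : R) (X : Omega -> R) :
    Omega -> R :=
  fun i => limn (series
    (fun k => iter k (mxapp (fun a b => t * A a b)) X i / k`!%:R)).

Definition exp_entry (A : Omega -> Omega -> R) (t : R) (i j : Omega) : R :=
  expapp A t (fun k => (k == j)%:R) i.

End L1.

Section MasterEquation.
Variables (R : realType) (Omega : choiceType).
(* g i j is the rate of the transition from i to j, whereas
   generator g i j is the entry in row i and column j. *)
Variable g : Omega -> Omega -> R.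

(* If the rates out of j are not summable, the diagonal entry is the junk value
   0; absolute summability of the off-diagonal entries excludes this. *)
Definition generator (i j : Omega) : R :=
  if i == j then - usum (g j) else g j i.

Definition irreducible_rates : Prop :=
  forall i j : Omega,
    exists p : seq Omega, path (fun a b => 0 < g a b) i p /\ last i p = j.

(* X, restricted to times t >= 0, is a continuous-time Markov chain started at
   w0 with P(X_{s+t} = i | X_s = j, history up to s) = (e^{t Gamma})^{(i,j)}.
   The history is a finite list h of pairs (time, state); the conditional
   probability is written in product form, so that null conditioning events
   need no special treatment.  Paths are right-continuous for the discrete
   topology of Omega, the standard convention under which the finite-dimensional
   distributions determine the law of the return time. *)
Definition is_ctmc (w0 : Omega) (d : measure_display) (T : measurableType d)
    (P : probability T R) (X : R -> T -> Omega) : Prop :=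
  [/\ forall (t : R) i, 0 <= t -> measurable [set w | X t w = i],
      forall w (t : R), 0 <= t -> \forall s \near t^'+, X s w = X t w,
      P [set w | X 0 w = w0] = 1%E
    & forall (h : seq (R * Omega)) (s t : R) (i j : Omega),
        0 <= s -> 0 <= t ->
        (forall p : R * Omega, p \in h -> 0 <= p.1 <= s) ->
        let H := [set w | forall p : R * Omega, p \in h -> X p.1 w = p.2]
                 `&` [set w | X s w = j] in
        P (H `&` [set w | X (s + t) w = i])
          = ((exp_entry generator t i j)%:E * P H)%E].

(* The infimum of the empty set is +oo. *)
Definition return_time (T : Type) (X : R -> T -> Omega) (w0 : Omega) (w : T) :
    \bar R :=
  ereal_inf [set t%:E | t in
    [set t : R | 0 < t /\ X t w = w0 /\
       exists tau, 0 < tau < t /\ X tau w <> w0]].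

(* The chain started at w0 is unique in law, so the choice of the probability
   space carrying it is immaterial.  The return time is measurable because its
   strict sublevel sets reduce, by right-continuity, to countable unions over
   rational times. *)
Definition positive_recurrent : Prop :=
  forall w0 : Omega,
    exists (d : measure_display) (T : measurableType d) (P : probability T R)
      (X : R -> T -> Omega),
      [/\ is_ctmc w0 P X,
          {ae P, forall w, (return_time X w0 w < +oo)%E}
        & (\int[P]_w return_time X w0 w < +oo)%E].

End MasterEquation.

(* Main.v *)
Require Import Defs.
From HB Require Import structures.
From mathcomp Require Import all_boot all_order all_algebra.
From mathcomp Require Import all_classical all_reals all_analysis.
From mathcomp Require Import measurable_realfun ring lra zify.

(* Write lam for a rate larger than all exit rates. Then Gamma = lam (K - 1)
   with K column-stochastic and with positive diagonal, and
   e^{t Gamma} = e^{-lam t} sum_n (lam t)^n / n! K^n, so it suffices to prove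
   that K^n X converges in l^1 for X >= 0.

   An invariant vector of K is sum_n (K')^n e_o, where K' is K with row o set
   to zero; its mass is the sum over n of the probability g_n that the chain K
   started at o avoids o at the times 1, ..., n. To bound this sum by the
   expected return time t_R, the continuous-time chain is observed on a grid of
   mesh delta / 2^m: its transition matrix over a step h is at least
   (1 - lam h) (1 + lam h K), which yields P(t_R >= n delta) >= g_(n+2) / 16
   once m tends to infinity, by right-continuity of the paths.

   Let pi be an invariant vector; pi > 0 by irreducibility. For U, V >= 0 of
   the same mass, the iterates K^n U are tight because U is dominated by a
   multiple of pi up to a vector of small mass. Some power K^M has its row o
   bounded below by b > 0 on a finite set carrying almost all the mass, so
   that the mass of (K^n U - K^n V)^+ is almost multiplied by 1 - b every M
   steps. *)

Set Implicit Arguments.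
Unset Strict Implicit.
Unset Printing Implicit Defensive.
Import Order.TTheory GRing.Theory Num.Theory.
Import numFieldNormedType.Exports.
Local Open Scope classical_set_scope.
Local Open Scope ring_scope.

(** * Sums of nonnegative families *)

Section NonnegativeSums.
Local Open Scope ereal_scope.
Context {R : realType}.
Implicit Types T : choiceType.

Lemma esumZl T (c : \bar R) (a : T -> \bar R) : 0 <= c -> (forall i, 0 <= a i) ->
  \esum_(i in [set: T]) (c * a i) = c * \esum_(i in [set: T]) a i.
Proof.
move=> c0 a0.
have sup_le : \esum_(i in [set: T]) (c * a i) <= c * \esum_(i in [set: T]) a i.
  apply: ge_ereal_sup => _ [X [finX XT]] <-.
  rewrite -ge0_mule_fsumr//; apply: lee_wpmul2l => //.
  by apply: ereal_sup_ubound; exists X.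
apply/eqP; rewrite eq_le sup_le/=.
case: c c0 sup_le => [r r0 _|_ _|//].
  rewrite -ereal_supZl//; last by apply/set0P; exists 0; exists set0;
    [exact: fsets_set0|rewrite fsbig_set0].
  apply: ge_ereal_sup => _ [_ [X [finX XT] <-] <-].
  by rewrite ge0_mule_fsumr//; apply: ereal_sup_ubound; exists X.
have [a_eq0|/existsNP[t /eqP at0]] := pselect (forall i, a i = 0).
  by rewrite (esum1 (a := a)) ?mule0 ?esum_ge0// => i _; rewrite a_eq0 mule0.
apply: le_trans (leey _) _.
apply: esum_ge; exists [set t]; first by split=> //; exact: finite_set1.
by rewrite fsbig_set1 gt0_mulye// lt0e at0 a0.
Qed.

Lemma exchange_esum T1 T2 (a : T1 -> T2 -> \bar R) :
  (forall i j, 0 <= a i j) ->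
  \esum_(i in [set: T1]) \esum_(j in [set: T2]) a i j =
  \esum_(j in [set: T2]) \esum_(i in [set: T1]) a i j.
Proof.
move=> a0; rewrite !esum_esum//.
rewrite (reindex_esum [set: T2 * T1] _ (fun p => (p.2, p.1))).
  rewrite (_ : [set: T2] `*`` (fun=> [set: T1]) = [set: T2 * T1])//.
  by apply/seteqP; split => -[].
split.
- by move=> [i j] _; split.
- by move=> [i j] [i' j'] _ _ /= [-> ->].
- by move=> [i j] _; exists (j, i).
Qed.

Lemma esum_ge1 T (a : T -> \bar R) t : (forall i, 0 <= a i) ->
  a t <= \esum_(i in [set: T]) a i.
Proof.
move=> a0; apply: esum_ge; exists [set t]; first by split=> //; exact: finite_set1.
by rewrite fsbig_set1.
Qed.

Lemma subset_esum T (A B : set T) (a : T -> \bar R) : A `<=` B ->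
  \esum_(i in A) a i <= \esum_(i in B) a i.
Proof.
move=> AB; apply: ge_ereal_sup => _ [X [finX XA] <-].
by apply: ereal_sup_ubound; exists X => //; split => // i /XA /AB.
Qed.

Lemma esum_delta T (f : T -> \bar R) o : (forall i, 0 <= f i) ->
  \esum_(i in [set: T]) (f i * (i == o)%:R%:E) = f o.
Proof.
move=> f0.
rewrite [LHS](_ : _ = \esum_(i in [set: T]) if i \in [set o] then f i else 0); last first.
  apply: eq_esum => i _; rewrite (_ : (i \in [set o]) = (i == o)).
    by case: eqP => _; rewrite ?mule1 ?mule0.
  by apply/idP/eqP; rewrite inE.
by rewrite -esum_mkcond esum_set1.
Qed.

Lemma esum_tail T (a : T -> \bar R) (e : R) : (forall i, 0 <= a i) ->
  \esum_(i in [set: T]) a i < +oo -> (0 < e)%R ->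
  exists s : seq T, \esum_(i in [set i | i \notin s]) a i <= e%:E.
Proof.
move=> a0 a_fin e0.
have afin : \esum_(i in [set: T]) a i \is a fin_num.
  by rewrite ge0_fin_numE// esum_ge0.
have [_ [X [/finite_seqP[s ->] _] <-] sX] := ub_ereal_sup_adherent e0 afin.
exists s; set y := esum _ _.
have y0 : 0 <= y by exact: esum_ge0.
have := @esumID R T [set` s] setT a (fun i _ => a0 i).
rewrite !setTI (_ : ~` [set` s] = [set i | i \notin s]); last first.
  by apply/seteqP; split => i /=; move/negP.
rewrite (esum_fset (F := [set` s]))// -/y => E.
move: sX afin; rewrite -/(esum _ _) E => {E}.
set x := (\sum_(i \in _) _)%R.
have x0 : 0 <= x by apply: fsume_ge0.
rewrite fin_numD => + /andP[].
case: (x) x0 => [x'| |]// x0'; case: (y) y0 => [y'| |]// _ + _ _.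
by rewrite -EFinD !lte_fin lee_fin => ?; lra.
Qed.

(** For nonnegative data in [0, +oo] sums always exist and may be exchanged, so finiteness has to be
    checked only before a subtraction. The entry [A i j] is the weight of the step from [j] to
    [i]. *)
Definition eapp T (A : T -> T -> \bar R) (v : T -> \bar R) (i : T) : \bar R :=
  \esum_(j in [set: T]) (A i j * v j).

Section Operator.
Variables (T : choiceType) (A : T -> T -> \bar R).
Hypothesis A_ge0 : forall i j, 0 <= A i j.
Implicit Types v w f : T -> \bar R.

Lemma eapp_ge0 v : (forall i, 0 <= v i) -> forall i, 0 <= eapp A v i.
Proof. by move=> v0 i; apply: esum_ge0 => j _; exact: mule_ge0. Qed.

Lemma le_eapp v w : (forall i, v i <= w i) -> forall i, eapp A v i <= eapp A w i.
Proof. by move=> vw i; apply: le_esum => j _; exact: lee_wpmul2l. Qed.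

Lemma eappD v w : (forall i, 0 <= v i) -> (forall i, 0 <= w i) ->
  eapp A (v \+ w) = eapp A v \+ eapp A w.
Proof.
move=> v0 w0; apply/funext => i; rewrite /eapp -esumD => [|j _|j _]; last 2 first.
- exact: mule_ge0.
- exact: mule_ge0.
by apply: eq_esum => j _; rewrite ge0_muleDr.
Qed.

Lemma eappZ c v : 0 <= c -> (forall i, 0 <= v i) ->
  eapp A (fun i => c * v i) = (fun i => c * eapp A v i).
Proof.
move=> c0 v0; apply/funext => i; rewrite /eapp -esumZl// => [|j].
  by apply: eq_esum => j _; rewrite muleCA.
exact: mule_ge0.
Qed.

(** The transpose is the adjoint: masses of forward iterates become backward iterates, which are
    functions of the starting state. *)
Lemma eapp_dual f v : (forall i, 0 <= f i) -> (forall i, 0 <= v i) ->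
  \esum_(i in [set: T]) (f i * eapp A v i) =
  \esum_(j in [set: T]) (eapp (fun i j => A j i) f j * v j).
Proof.
move=> f0 v0.
transitivity (\esum_(i in [set: T]) \esum_(j in [set: T]) (f i * (A i j * v j))).
  by apply: eq_esum => i _; rewrite esumZl// => j; exact: mule_ge0.
rewrite exchange_esum; last by move=> i j; rewrite !mule_ge0.
apply: eq_esum => j _; rewrite muleC -esumZl//; last by move=> i; exact: mule_ge0.
by apply: eq_esum => i _; rewrite muleA [in RHS]muleC [f i * _]muleC.
Qed.

Lemma iter_eapp_ge0 n v : (forall i, 0 <= v i) -> forall i, 0 <= iter n (eapp A) v i.
Proof. by move=> v0; elim: n => //= n IH; exact: eapp_ge0. Qed.

Lemma le_iter_eapp n v w : (forall i, v i <= w i) ->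
  forall i, iter n (eapp A) v i <= iter n (eapp A) w i.
Proof. by move=> vw; elim: n => //= n IH; exact: le_eapp. Qed.

Lemma iter_eappD n v w : (forall i, 0 <= v i) -> (forall i, 0 <= w i) ->
  iter n (eapp A) (v \+ w) = iter n (eapp A) v \+ iter n (eapp A) w.
Proof.
by move=> v0 w0; elim: n => //= n ->; rewrite eappD//; exact: iter_eapp_ge0.
Qed.

Lemma iter_eappZ n c v : 0 <= c -> (forall i, 0 <= v i) ->
  iter n (eapp A) (fun i => c * v i) = (fun i => c * iter n (eapp A) v i).
Proof.
by move=> c0 v0; elim: n => //= n ->; rewrite eappZ//; exact: iter_eapp_ge0.
Qed.

End Operator.

Lemma iter_eapp_dual T (A : T -> T -> \bar R) n f v : (forall i j, 0 <= A i j) ->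
  (forall i, 0 <= f i) -> (forall i, 0 <= v i) ->
  \esum_(i in [set: T]) (f i * iter n (eapp A) v i) =
  \esum_(j in [set: T]) (iter n (eapp (fun i j => A j i)) f j * v j).
Proof.
move=> A0; elim: n f => //= n IH f f0 v0.
rewrite eapp_dual//; last exact: iter_eapp_ge0.
by rewrite IH// -?iterSr//; exact: eapp_ge0.
Qed.

End NonnegativeSums.

(** * An invariant vector from summable survival probabilities *)

Section InvariantVector.
Local Open Scope ereal_scope.
Variables (R : realType) (T : choiceType) (K : T -> T -> \bar R) (o : T).
Hypothesis K_ge0 : forall i j, 0 <= K i j.
Hypothesis K_stochastic : forall j, \esum_(i in [set: T]) K i j = 1.

Lemma esum_eapp (v : T -> \bar R) : (forall i, 0 <= v i) ->
  \esum_(i in [set: T]) eapp K v i = \esum_(i in [set: T]) v i.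
Proof.
move=> v0; have := eapp_dual (A := K) K_ge0 (f := cst 1) (v := v) (fun=> lee01) v0.
under eq_esum do rewrite mul1e; move=> ->; apply: eq_esum => j _.
rewrite -[RHS]mul1e; congr (_ * _); rewrite -[RHS](K_stochastic j).
by apply: eq_esum => i _; rewrite /= mule1.
Qed.

Lemma esum_iter_eapp n (v : T -> \bar R) : (forall i, 0 <= v i) ->
  \esum_(i in [set: T]) iter n (eapp K) v i = \esum_(i in [set: T]) v i.
Proof.
move=> v0; elim: n => //= n IH; rewrite esum_eapp//; exact: iter_eapp_ge0.
Qed.

(** Transitions into [o] are deleted, so the iterates carry only the mass that has not yet returned
    to [o]. *)
Definition taboo (i j : T) : \bar R := if i == o then 0 else K i j.

Lemma taboo_ge0 i j : 0 <= taboo i j.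
Proof. by rewrite /taboo; case: ifP. Qed.

(* The probability that the chain with matrix K started at j avoids o at the
   times 1, ..., n. *)
Definition survival n : T -> \bar R := iter n (eapp (fun i j => taboo j i)) (cst 1).

Lemma survival_ge0 n j : 0 <= survival n j.
Proof. by apply: iter_eapp_ge0 => // i k; exact: taboo_ge0. Qed.

Lemma survivalS n j :
  survival n.+1 j = \esum_(i in [set: T]) (taboo i j * survival n i).
Proof. by []. Qed.

Lemma survival_nonincreasing n j : survival n.+1 j <= survival n j.
Proof.
elim: n j => [|n IH] j; last first.
  by rewrite !survivalS; apply: le_esum => i _; rewrite lee_wpmul2l ?taboo_ge0.
rewrite survivalS -[leRHS](K_stochastic j); apply: le_esum => i _.
by rewrite /= mule1 /taboo; case: ifP.
Qed.

Lemma survival_le1 n j : survival n j <= 1.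
Proof. by elim: n => // n; apply: le_trans; exact: survival_nonincreasing. Qed.

(** Cycle formula: [pi i] is the expected number of visits to [i] before the first return to [o],
    and the sum of the survival probabilities is the total mass of [pi], that is, the mean return
    time of the discrete chain. *)
Lemma exists_invariant : \esum_(n in [set: nat]) survival n o < +oo ->
  exists pi : T -> \bar R, [/\ forall i, 0 <= pi i, pi o = 1,
    \esum_(i in [set: T]) pi i < +oo & eapp K pi = pi].
Proof.
move=> fin_o.
pose v n : T -> \bar R := iter n (eapp taboo) (fun i => (i == o)%:R%:E).
have v0_ge0 i : 0 <= (i == o)%:R%:E :> \bar R by rewrite lee_fin ler0n.
have v_ge0 n i : 0 <= v n i by apply: iter_eapp_ge0 => [j k|]; [exact: taboo_ge0|exact: v0_ge0].
have vS_o n : v n.+1 o = 0.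
  by rewrite /= /eapp esum1// => j _; rewrite /taboo eqxx mul0e.
have mass_v n : \esum_(i in [set: T]) v n i = survival n o.
  have := iter_eapp_dual n (f := cst 1) taboo_ge0 (fun=> lee01) v0_ge0.
  under eq_esum do rewrite mul1e; move=> ->.
  by rewrite -/(survival n) esum_delta// => j; exact: survival_ge0.
pose pi i := \esum_(n in [set: nat]) v n i.
have pi_ge0 i : 0 <= pi i by exact: esum_ge0.
have pi_split i : pi i = v 0%N i + \esum_(n in [set: nat]) v n.+1 i.
  rewrite /pi (esumID [set 0%N])// !setTI esum_set1//; congr (_ + _).
  apply: reindex_esum; split=> [n _ //|n m _ _ []//|[|n] //= _].
  by exists n.
have Kpi_ge0 i : 0 <= eapp K pi i by exact: eapp_ge0.
have mass_pi : \esum_(i in [set: T]) pi i = \esum_(n in [set: nat]) survival n o.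
  by rewrite exchange_esum//; apply: eq_esum => n _; exact: mass_v.
have pi_fin i : pi i \is a fin_num.
  rewrite ge0_fin_numE//; apply: le_lt_trans (esum_ge1 i pi_ge0) _.
  by rewrite mass_pi.
(* Away from [o] the matrices [K] and [taboo] agree, so applying [K] shifts the sum over [n] by one;
   the term [v 0] that is lost vanishes there. *)
have Kpi_i i : i != o -> eapp K pi i = pi i.
  move=> io; rewrite pi_split /= (negbTE io) add0e /eapp /pi.
  under eq_esum => j _ do rewrite -esumZl//.
  rewrite exchange_esum; last by move=> j n; exact: mule_ge0.
  apply: eq_esum => n _; rewrite /= /eapp; apply: eq_esum => j _.
  by rewrite /taboo (negbTE io).
have split_o (w : T -> \bar R) : (forall i, 0 <= w i) ->
    \esum_(i in [set: T]) w i = w o + \esum_(i in ~` [set o]) w i.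
  by move=> w0; rewrite (esumID [set o])// !setTI esum_set1.
exists pi; split => //.
- rewrite pi_split /= eqxx esum1 ?adde0// => n _; exact: vS_o.
- by rewrite mass_pi.
apply/funext => i; have [->{i}|] := eqVneq i o; last exact: Kpi_i.
(* [K] preserves the total mass and fixes [pi] off [o]; cancelling the finite mass off [o] yields
   equality at [o]. *)
have := esum_eapp pi_ge0; rewrite !split_o//.
rewrite (eq_esum (b := pi)); last by move=> i /eqP; exact: Kpi_i.
have rest_fin : \esum_(i in ~` [set o]) pi i \is a fin_num.
  rewrite ge0_fin_numE ?esum_ge0//.
  apply: le_lt_trans fin_o; rewrite -mass_pi (split_o pi)// leeDr//.
by move=> /(congr1 (fun z => z - \esum_(i in ~` [set o]) pi i)); rewrite !addeK.
Qed.

End InvariantVector.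

(** * Convergence of the powers of a stochastic matrix *)

(** The last hypothesis says that [d] loses at least [b] times [d n - e] in [m] steps. With
    tolerance [e / 2], every block of [m] steps that starts above [e] costs at least [b * (e / 2)],
    which can happen only finitely often. *)
Lemma contracting_to_zero (R : realType) (d : nat -> R) :
  (forall n, 0 <= d n) -> (forall n, d n.+1 <= d n) ->
  (forall e, 0 < e -> exists m, exists2 b, 0 < b &
     forall n, d (m + n)%N + b * d n <= d n + b * e) ->
  forall e, 0 < e -> exists N, forall n, (N <= n)%N -> d n <= e.
Proof.
move=> d0 d_dec d_step e e0.
have e20 : 0 < e / 2 by rewrite divr_gt0.
have [m [b b0 hb]] := d_step _ e20.
have d_le n k : (n <= k)%N -> d k <= d n.
  by move=> /subnK <-; elim: (k - n)%N => //= l; apply: le_trans; exact: d_dec.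
have dec k : d (k * m)%N <= e \/ d (k * m)%N <= d 0%N - k%:R * (b * (e / 2)).
  elim: k => [|k IH]; first by right; rewrite mul0r subr0.
  have [le_e|gt_e] := leP (d (k * m)%N) e.
    by left; apply: le_trans le_e; apply: d_le; rewrite mulSn leq_addl.
  case: IH => [|IH]; first by rewrite leNgt gt_e.
  right; rewrite mulSn -natr1; have := hb (k * m)%N.
  have : b * e <= b * d (k * m)%N by rewrite ler_pM2l// ltW.
  by nra.
have be0 : 0 < b * (e / 2) by rewrite mulr_gt0.
pose k := (Num.truncn (d 0%N / (b * (e / 2)))).+1.
exists (k * m)%N => n /d_le /le_trans; apply.
case: (dec k) => // /(le_trans (d0 _)); rewrite subr_ge0 -ler_pdivlMr//.
by rewrite leNgt truncnS_gt.
Qed.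

Section Convergence.
Local Open Scope ereal_scope.
Variables (R : realType) (T : choiceType) (K : T -> T -> \bar R).
Hypothesis K_ge0 : forall i j, 0 <= K i j.
Hypothesis K_stochastic : forall j, \esum_(i in [set: T]) K i j = 1.
Hypothesis K_diag : forall j, 0 < K j j.
Hypothesis K_connected : forall i j,
  exists p, path (fun a b => 0 < K b a) i p /\ last i p = j.

Lemma invariant_gt0 (pi : T -> \bar R) o : (forall i, 0 <= pi i) -> 0 < pi o ->
  eapp K pi = pi -> forall i, 0 < pi i.
Proof.
move=> pi0 pio Kpi i; have [p [+ <-]] := K_connected o i.
elim: p o pio => //= b p IH a pia /andP[Kba]; apply: IH.
rewrite -Kpi; apply: lt_le_trans (mule_gt0 Kba pia) _.
by apply: (esum_ge1 (a := fun j => K b j * pi j)) => j; exact: mule_ge0.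
Qed.

(** Row [o] of the n-th power of [K]: the probability of being at [o] after [n] steps from a given
    state. *)
Let hit o n : T -> \bar R :=
  iter n (eapp (fun i j => K j i)) (fun i => (i == o)%:R%:E).

Let hit_ge0 o n i : 0 <= hit o n i.
Proof. by apply: iter_eapp_ge0 => // j; rewrite lee_fin. Qed.

Let hit_gt0S o n i j : 0 < K i j -> 0 < hit o n i -> 0 < hit o n.+1 j.
Proof.
move=> Kij hi; apply: lt_le_trans (mule_gt0 Kij hi) _.
apply: (esum_ge1 (a := fun i => K i j * hit o n i)) => k; exact: mule_ge0.
Qed.

(* Positive diagonal entries make the chain aperiodic. *)
Let hit_gt0 o j : exists m, forall n, (m <= n)%N -> 0 < hit o n j.
Proof.
have [p [pp lp]] := K_connected j o.
suff [m hm] : exists m, 0 < hit o m j.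
  exists m; elim => [|n IH]; first by rewrite leqn0 => /eqP <-.
  rewrite leq_eqVlt => /predU1P[<-//|/IH]; exact: hit_gt0S.
elim: p j pp lp => [j _ <-|b p IH j /= /andP[Kbj] /IH{}IH /IH[m hm]].
  by exists 0%N; rewrite /hit /= eqxx.
by exists m.+1; exact: hit_gt0S hm.
Qed.

(** Aperiodicity gives one [n] for which every state of the finite list is at [o] after [n] steps
    with positive probability; [b] is a minimum of finitely many positive numbers. *)
Let hit_lower o (s : seq T) : exists n, exists2 b : R, (0 < b)%R &
  forall j, j \in s -> b%:E <= hit o n j.
Proof.
have [n n_gt0] : exists n, forall m, (n <= m)%N -> forall j, j \in s -> 0 < hit o m j.
  elim: s => [|a s [n IH]]; first by exists 0%N.
  have [m hm] := hit_gt0 o a; exists (maxn n m) => k; rewrite geq_max => /andP[nk mk] j.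
  by rewrite inE => /predU1P[->|]; [exact: hm|exact: IH].
exists n; have {}n_gt0 := n_gt0 n (leqnn n).
elim: s n_gt0 => [|a s IH] n_gt0; first by exists 1%R.
have [|b b0 hb] := IH; first by move=> j js; apply: n_gt0; rewrite inE js orbT.
have : 0 < hit o n a by apply: n_gt0; rewrite mem_head.
case hx : (hit o n a) => [x| |//]; last first.
  by exists b => // j; rewrite inE => /predU1P[->|/hb//]; rewrite hx leey.
rewrite lte_fin => x0; exists (Num.min b x); first by rewrite lt_min b0.
move=> j; rewrite inE => /predU1P[->|/hb]; first by rewrite hx lee_fin ge_min lexx orbT.
by apply: le_trans; rewrite lee_fin ge_min lexx.
Qed.

(* Up to a vector of small mass, U is at most a multiple of the invariant
   vector, and this property is preserved by K. *)
Let iter_tight (pi U : T -> \bar R) (e : R) :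
  (forall i, 0 < pi i) -> \esum_(i in [set: T]) pi i < +oo -> eapp K pi = pi ->
  (forall i, 0 <= U i) -> \esum_(i in [set: T]) U i < +oo -> (0 < e)%R ->
  exists s : seq T, forall n,
    \esum_(i in [set i | i \notin s]) iter n (eapp K) U i <= e%:E.
Proof.
move=> pi_gt0 pi_fin Kpi U0 U_fin e0.
have pi_ge0 i : 0 <= pi i by exact: ltW.
have e20 : (0 < e / 2)%R by rewrite divr_gt0.
have [F UF] := esum_tail U0 U_fin e20.
have fin (a : T -> \bar R) : (forall i, 0 <= a i) ->
    \esum_(i in [set: T]) a i < +oo -> forall i, a i \is a fin_num.
  by move=> a0 a_fin i; rewrite ge0_fin_numE// (le_lt_trans (esum_ge1 i a0)).
have [c c0 Uc] : exists2 c : R, (0 < c)%R & forall i, i \in F -> U i <= c%:E * pi i.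
  elim: F {UF} => [|a F [c c0 IH]]; first by exists 1%R.
  exists (c + fine (U a) / fine (pi a))%R.
    by rewrite ltr_wpDr// divr_ge0// fine_ge0.
  move=> i; rewrite EFinD ge0_muleDl ?lee_fin; last 2 first.
  - exact: ltW.
  - by rewrite divr_ge0// fine_ge0.
  rewrite inE => /predU1P[->{i}|/IH /le_trans]; last first.
    by apply; rewrite leeDl// mule_ge0// lee_fin divr_ge0// fine_ge0.
  apply: le_trans (_ : (fine (U a) / fine (pi a))%:E * pi a <= _).
    rewrite -{2}(fineK (fin _ pi_ge0 pi_fin a)) -EFinM divfK ?fineK ?fin//.
    by rewrite gt_eqF// fine_gt0// pi_gt0 ltey_eq fin.
  by rewrite leeDr// mule_ge0// lee_fin ltW.
have [|J piJ] := esum_tail pi_ge0 pi_fin (e := (e / 2 / c)%R); first by rewrite divr_gt0.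
pose r i := if i \in F then 0 else U i.
have r0 i : 0 <= r i by rewrite /r; case: ifP.
exists J => n.
have cpi0 i : 0 <= c%:E * pi i by rewrite mule_ge0// lee_fin ltW.
(* [U] is at most [c] times [pi] plus the part [r] of [U] off [F]. The first summand is invariant,
   the second keeps its mass, which is at most [e / 2]. *)
have U_le i : iter n (eapp K) U i <= c%:E * pi i + iter n (eapp K) r i.
  have -> : c%:E * pi i + iter n (eapp K) r i =
      iter n (eapp K) ((fun i => c%:E * pi i) \+ r) i.
    rewrite iter_eappD// iter_eappZ ?lee_fin ?(ltW c0)//=.
    by rewrite (_ : iter n (eapp K) [eta pi] = pi)//; elim: n => //= n ->.
  apply: le_iter_eapp => // {}i; rewrite /r /=; case: ifPn => [/Uc|_].
    by rewrite adde0.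
  by rewrite leeDr.
apply: le_trans (le_esum (fun i _ => U_le i)) _.
rewrite esumD => [|//|i _]; last exact: iter_eapp_ge0.
have -> : e%:E = (e / 2)%:E + (e / 2)%:E by rewrite -EFinD -splitr.
apply: leeD.
  rewrite esum_mkcond (_ : esum _ _ =
      c%:E * \esum_(i in [set i | i \notin J]) pi i).
    rewrite [leRHS](_ : _ = c%:E * (e / 2 / c)%:E).
      by rewrite lee_wpmul2l// lee_fin ltW.
    by rewrite -EFinM [(c * _)%R]mulrC divfK// gt_eqF.
  rewrite [in RHS]esum_mkcond -esumZl ?lee_fin ?(ltW c0)//; last first.
    by move=> i; case: ifP.
  by apply: eq_esum => i _; case: ifP; rewrite ?mule0.
have iter_r0 i : 0 <= iter n (eapp K) r i by exact: iter_eapp_ge0.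
apply: le_trans (_ : \esum_(i in [set: T]) iter n (eapp K) r i <= _).
  exact: subset_esum.
rewrite (esum_iter_eapp K_ge0 K_stochastic)//; apply: le_trans UF.
rewrite [in leRHS]esum_mkcond; apply: le_esum => i _; rewrite /r.
rewrite (_ : (i \in [set i | i \notin F]) = (i \notin F)); first by case: (i \in F).
by apply/idP/idP; rewrite inE.
Qed.

(** Mass of the positive part of the difference; for finite equal masses it is half of the l^1
    distance. *)
Let excess (U V : T -> \bar R) : \bar R :=
  \esum_(i in [set: T]) maxe (U i - V i) 0.

(** The common part of [U] and [V] cancels. The remainders [W] and [W'] have equal mass, and after
    [n] steps each puts on [o] at least [b] times the mass that it had in [s]; what both put there
    cancels as well. *)
Let excess_step (U V : T -> \bar R) n :
  (forall i, 0 <= U i) -> (forall i, 0 <= V i) ->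
  \esum_(i in [set: T]) U i < +oo ->
  \esum_(i in [set: T]) U i = \esum_(i in [set: T]) V i ->
  excess V U = excess U V /\
  forall o (s : seq T) (b e : R), (0 <= b)%R ->
  (forall j, j \in s -> b%:E <= hit o n j) ->
  \esum_(i in [set i | i \notin s]) U i <= e%:E ->
  \esum_(i in [set i | i \notin s]) V i <= e%:E ->
  excess (iter n (eapp K) U) (iter n (eapp K) V) + b%:E * excess U V <=
    excess U V + b%:E * e%:E.
Proof.
move=> U0 V0 U_fin UV.
have fin (a : T -> \bar R) : (forall i, 0 <= a i) ->
    \esum_(i in [set: T]) a i < +oo -> forall i, a i \is a fin_num.
  by move=> a0 a_fin i; rewrite ge0_fin_numE// (le_lt_trans (esum_ge1 i a0)).
have V_fin : \esum_(i in [set: T]) V i < +oo by rewrite -UV.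
pose m i := mine (U i) (V i).
pose W i := maxe (U i - V i) 0; pose W' i := maxe (V i - U i) 0.
have m0 i : 0 <= m i by rewrite le_min U0 V0.
have W0 i : 0 <= W i by rewrite le_max lexx orbT.
have W'0 i : 0 <= W' i by rewrite le_max lexx orbT.
have UE : U = W \+ m.
  apply/funext => i; rewrite /W /m /= .
  have := fin _ U0 U_fin i; have := fin _ V0 V_fin i.
  case: (U i) => [u| |]//; case: (V i) => [v| |]// _ _.
  rewrite -EFinB -EFin_max -EFin_min -EFinD; congr _%:E.
  by case: (lerP u v) => uv; [rewrite max_r ?subr_le0// add0r|
    rewrite max_l ?subr_ge0 ?(ltW uv)// subrK].
have VE : V = W' \+ m.
  apply/funext => i; rewrite /W' /m /= .
  have := fin _ U0 U_fin i; have := fin _ V0 V_fin i.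
  case: (U i) => [u| |]//; case: (V i) => [v| |]// _ _.
  rewrite -EFinB -EFin_max -EFin_min -EFinD; congr _%:E.
  by case: (lerP u v) => uv; [rewrite max_l ?subr_ge0// subrK|
    rewrite max_r ?subr_le0 ?(ltW uv)// add0r].
have WU i : W i <= U i by rewrite UE /= leeDl.
have W'V i : W' i <= V i by rewrite VE /= leeDl.
have m_fin : \esum_(i in [set: T]) m i \is a fin_num.
  rewrite ge0_fin_numE ?esum_ge0//; apply: le_lt_trans U_fin.
  by apply: le_esum => i _; rewrite UE /= leeDr.
have W_fin : \esum_(i in [set: T]) W i \is a fin_num.
  by rewrite ge0_fin_numE ?esum_ge0//; apply: le_lt_trans U_fin; exact: le_esum.
have WW' : \esum_(i in [set: T]) W' i = \esum_(i in [set: T]) W i.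
  move: UV; rewrite UE VE !esumD// => /(congr1 (fun z => z - \esum_(i in [set: T]) m i)).
  by rewrite !addeK.
split; first exact: WW'.
move=> o s b e b0 hb Us Vs.
pose A := iter n (eapp K) W; pose B := iter n (eapp K) W'.
have A0 i : 0 <= A i by exact: iter_eapp_ge0.
have B0 i : 0 <= B i by exact: iter_eapp_ge0.
have Afin : forall i, A i \is a fin_num.
  apply: fin => //; rewrite /A (esum_iter_eapp K_ge0 K_stochastic)//.
  by rewrite -ge0_fin_numE ?esum_ge0.
have Bfin : forall i, B i \is a fin_num.
  apply: fin => //; rewrite /B (esum_iter_eapp K_ge0 K_stochastic)// WW'.
  by rewrite -ge0_fin_numE ?esum_ge0.
(* By duality the mass at [o] after [n] steps is the pairing of [X] with [hit o n], which is at
   least [b] on [s]; the mass off [s] is at most [e]. *)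
have mass_o (X Y : T -> \bar R) : (forall i, 0 <= X i) -> (forall i, X i <= Y i) ->
    \esum_(i in [set i | i \notin s]) Y i <= e%:E ->
    b%:E * (\esum_(i in [set: T]) X i) <= iter n (eapp K) X o + b%:E * e%:E.
  move=> X0 XY Ye.
  rewrite (esumID [set i | i \in s])// !setTI ge0_muleDr ?esum_ge0//.
  apply: leeD; last first.
    apply: lee_wpmul2l; first by rewrite lee_fin.
    apply: le_trans Ye; rewrite (_ : ~` [set i | i \in s] = [set i | i \notin s]).
      exact: le_esum.
    by apply/seteqP; split => i /= /negP.
  have iX0 i : 0 <= iter n (eapp K) X i by exact: iter_eapp_ge0.
  rewrite -(esum_delta (f := iter n (eapp K) X) o)//.
  under [leRHS]eq_esum do rewrite muleC.
  rewrite iter_eapp_dual//.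
  rewrite esum_mkcond -esumZl ?lee_fin//; last by move=> i; case: ifP.
  apply: le_esum => j _; case: ifPn; rewrite ?inE /= => js.
    by apply: lee_wpmul2r => //; exact: hb.
  by rewrite mule0 mule_ge0// hit_ge0.
(* Off [o] the positive part of A - B is at most A; at [o] it equals A minus the minimum of A and
   B. *)
have key : excess (iter n (eapp K) U) (iter n (eapp K) V) + mine (A o) (B o) <=
    \esum_(i in [set: T]) W i.
  rewrite -(esum_iter_eapp K_ge0 K_stochastic n W0) -/A.
  have mo : 0 <= mine (A o) (B o) by rewrite le_min A0 B0.
  rewrite -(esum_delta (f := fun=> mine (A o) (B o)) o)// -esumD => [|i _|i _]; last 2 first.
  - by rewrite le_max lexx orbT.
  - by rewrite mule_ge0// lee_fin.
  apply: le_esum => i _; rewrite UE VE !iter_eappD//= -/A -/B.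
  have mi : iter n (eapp K) m i \is a fin_num.
    apply: (fin _ _ _ i); first exact: iter_eapp_ge0.
    by rewrite (esum_iter_eapp K_ge0 K_stochastic)// -ge0_fin_numE ?esum_ge0.
  have := Afin i; have := Bfin i; have := A0 i; have := B0 i; move: mi.
  have := Afin o; have := Bfin o.
  have [->|_] := eqVneq i o; last first.
    rewrite mule0 adde0 => _ _.
    case: (A i) => [a| |]//; case: (B i) => [c| |]//; case: (iter n (eapp K) m i) => [z| |]//.
    rewrite -!EFinD -EFin_max !lee_fin => _ ? ? _ _.
    by rewrite ge_max; apply/andP; split; lra.
  move=> _ _.
  case: (A o) => [a| |]//; case: (B o) => [c| |]//; case: (iter n (eapp K) m o) => [z| |]//.
  rewrite mule1 -!EFinD -EFin_max -EFin_min -EFinD !lee_fin => _ ? ? _ _.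
  by case: (lerP (a + z - (c + z)) 0) => ?; case: (lerP a c) => ?; lra.
have b_le : b%:E * (\esum_(i in [set: T]) W i) <= mine (A o) (B o) + b%:E * e%:E.
  case: (leP (A o) (B o)) => _; first exact: (mass_o W U).
  by rewrite -WW'; exact: (mass_o W' V).
apply: le_trans (leeD (le_refl _) b_le) _.
by rewrite addeA; apply: leeD.
Qed.

(** Tightness confines both sequences to a finite list up to mass [e], a power of [K] has its row
    [o] bounded below on that list, and the excess therefore contracts. *)
Lemma iter_eapp_merge (pi U V : T -> \bar R) (o : T) :
  (forall i, 0 <= pi i) -> 0 < pi o -> \esum_(i in [set: T]) pi i < +oo ->
  eapp K pi = pi ->
  (forall i, 0 <= U i) -> (forall i, 0 <= V i) ->
  \esum_(i in [set: T]) U i < +oo ->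
  \esum_(i in [set: T]) U i = \esum_(i in [set: T]) V i ->
  forall e : R, (0 < e)%R -> exists N, forall n, (N <= n)%N ->
    \esum_(i in [set: T]) `|iter n (eapp K) U i - iter n (eapp K) V i| <= e%:E.
Proof.
move=> pi0 pio pi_fin Kpi U0 V0 U_fin UV.
have pi_gt0 := invariant_gt0 pi0 pio Kpi.
pose u n := iter n (eapp K) U; pose v n := iter n (eapp K) V.
have u0 n i : 0 <= u n i by exact: iter_eapp_ge0.
have v0 n i : 0 <= v n i by exact: iter_eapp_ge0.
have mass_u n : \esum_(i in [set: T]) u n i = \esum_(i in [set: T]) U i.
  exact: esum_iter_eapp.
have mass_v n : \esum_(i in [set: T]) v n i = \esum_(i in [set: T]) V i.
  exact: esum_iter_eapp.
have u_fin n : \esum_(i in [set: T]) u n i < +oo by rewrite mass_u.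
have uv n : \esum_(i in [set: T]) u n i = \esum_(i in [set: T]) v n i.
  by rewrite mass_u mass_v.
have step n m := excess_step m (u0 n) (v0 n) (u_fin n) (uv n).
have max0 (x y : \bar R) : 0 <= maxe (x - y) 0 by rewrite le_max lexx orbT.
have uN_fin n i : u n i \is a fin_num.
  by rewrite ge0_fin_numE// (le_lt_trans (esum_ge1 i (u0 n)))// mass_u.
have vN_fin n i : v n i \is a fin_num.
  by rewrite ge0_fin_numE// (le_lt_trans (esum_ge1 i (v0 n)))// mass_v -UV.
have exc_fin n : excess (u n) (v n) \is a fin_num.
  rewrite ge0_fin_numE ?esum_ge0//; apply: le_lt_trans U_fin; rewrite -(mass_u n).
  apply: le_esum => i _; move: (u0 n i) (v0 n i) (uN_fin n i) (vN_fin n i).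
  case: (u n i) => [x| |]//; case: (v n i) => [y| |]// + + _ _.
  by rewrite -EFinD -EFin_max !lee_fin ge_max => x0 y0; apply/andP; split; lra.
pose d n := fine (excess (u n) (v n)).
have dE n : excess (u n) (v n) = (d n)%:E by rewrite fineK.
have iterE (X : T -> \bar R) m n : iter m (eapp K) (iter n (eapp K) X) = iter (m + n) (eapp K) X.
  by rewrite iterD.
have d_cvg : forall e, (0 < e)%R -> exists N, forall n, (N <= n)%N -> (d n <= e)%R.
  apply: contracting_to_zero => [n|n|e e0]; first by rewrite fine_ge0 ?esum_ge0.
    (* With the empty list and the factor 0, one step shows that the excess does not increase; the
       tolerance may then be the total mass. *)
    have [_ /(_ o [::] 0%R (fine (\esum_(i in [set: T]) U i)))] := step n 1%N.
    rewrite -[iter 1 _ (u n)]/(u n.+1) -[iter 1 _ (v n)]/(v n.+1) !dE.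
    rewrite !mul0e !adde0 lee_fin; apply => //.
    - rewrite fineK ?ge0_fin_numE ?esum_ge0// -(mass_u n).
      exact: subset_esum.
    - rewrite fineK ?ge0_fin_numE ?esum_ge0// UV -(mass_v n).
      exact: subset_esum.
  have [s us] := iter_tight pi_gt0 pi_fin Kpi U0 U_fin e0.
  have [|s' vs] := iter_tight pi_gt0 pi_fin Kpi V0 _ e0; first by rewrite -UV.
  have [m [b b0 hb]] := hit_lower o (s ++ s').
  exists m, b => // n.
  have [_ /(_ o (s ++ s') b e (ltW b0) hb)] := step n m.
  rewrite !iterE -/(u _) -/(v _) !dE -!EFinM -!EFinD lee_fin; apply.
    apply: le_trans (us n); apply: subset_esum => i /=.
    by rewrite mem_cat negb_or => /andP[].
  apply: le_trans (vs n); apply: subset_esum => i /=.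
  by rewrite mem_cat negb_or => /andP[].
move=> e e0; have [|N hN] := d_cvg (e / 2)%R; first by rewrite divr_gt0.
exists N => n /hN dn.
have [exc_sym _] := step n 0%N.
rewrite (_ : esum _ _ = excess (u n) (v n) + excess (v n) (u n)).
  by rewrite exc_sym dE -EFinD lee_fin; lra.
rewrite -esumD//; apply: eq_esum => i _.
rewrite -/(u n) -/(v n); move: (uN_fin n i) (vN_fin n i).
case: (u n i) => [x| |]//; case: (v n i) => [y| |]// _ _.
rewrite -!EFinD -!EFin_max -EFinD /=; congr _%:E.
by case: (lerP (x - y) 0) => ?; case: (lerP (y - x) 0) => ?;
  [rewrite ler0_norm|rewrite ler0_norm|rewrite ger0_norm|rewrite ger0_norm]; lra.
Qed.

End Convergence.

(** * Uniformization *)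

Section BinomialTransform.
Variable R : realType.
Implicit Types (y C : R) (A : nat -> nat -> R).

(** Newton's forward difference formula: by hypothesis [k] counts the differences taken in [n]. *)
Lemma iterated_difference A (n k : nat) :
  (forall n k, A n k.+1 = A n.+1 k - A n k) ->
  A n k = \sum_(j < n.+1) 'C(n, j)%:R * A 0%N (k + j)%N.
Proof.
move=> dA; elim: n k => [|n IH] k; first by rewrite big_ord1 bin0 mul1r addn0.
have -> : A n.+1 k = A n k + A n k.+1 by rewrite dA addrC subrK.
rewrite big_ord_recl /= bin0 mul1r addn0.
under eq_bigr do rewrite /bump /= add1n binS natrD mulrDl addnS -addSn.
rewrite big_split /= addrA -IH; congr (_ + _).
rewrite IH big_ord_recl bin0 mul1r addn0; congr (_ + _).
rewrite [in RHS]big_ord_recr /= bin_small// mul0r addr0.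
by apply: eq_bigr => j _; rewrite /bump /= add1n addnS addSn.
Qed.

Lemma exp_coeff_series_le y n : 0 <= y -> series (exp_coeff y) n <= expR y.
Proof.
move=> y0; apply: nondecreasing_cvgn_le; last exact: is_cvg_series_exp_coeff.
by apply: nondecreasing_series => k _ _; exact: exp_coeff_ge0.
Qed.

(** For k >= n the coefficient at [y] is at most the coefficient at [2 * y] divided by 2^n. *)
Lemma exp_coeff_tail y n : 0 <= y ->
  0 <= expR y - series (exp_coeff y) n <= expR (2 * y) / 2 ^+ n.
Proof.
move=> y0; rewrite subr_ge0 exp_coeff_series_le//= lerBlDr.
apply: limr_le; first exact: is_cvg_series_exp_coeff.
near=> m; have nm : (n <= m)%N by near: m; exact: nbhs_infty_ge.
rewrite -lerBlDr sub_series_geq//.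
rewrite ler_pdivlMr ?exprn_gt0// mulr_suml.
have y20 : 0 <= 2 * y by rewrite mulr_ge0.
apply: le_trans (exp_coeff_series_le m y20); rewrite seriesEnat /=.
rewrite (big_cat_nat (leq0n n) nm)/=.
rewrite -[leLHS]add0r; apply: lerD; first by apply: sumr_ge0 => k _; exact: exp_coeff_ge0.
rewrite big_nat_cond [leRHS]big_nat_cond.
apply: ler_sum => k /andP[/andP[nk _] _].
rewrite /exp_coeff /= exprMn [leLHS]mulrC mulrA ler_wpM2r ?invr_ge0//.
by apply: ler_wpM2r; rewrite ?exprn_ge0// ler_weXn2l// ler1n.
Unshelve. all: by end_near. Qed.

(* Applied to A n k = (K^n (K - 1)^k X)^(i), this is the identity
   e^{y K} = e^y e^{y (K - 1)}. *)
Lemma binomial_transform_exp A y C : 0 <= y ->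
  (forall n k, A n k.+1 = A n.+1 k - A n k) -> (forall n, `|A n 0%N| <= C) ->
  series (fun n => y ^+ n / n`!%:R * A n 0%N) @ \oo -->
    expR y * limn (series (fun k => y ^+ k * A 0%N k / k`!%:R)).
Proof.
move=> y0 dA AC.
have C0 : 0 <= C by apply: le_trans (AC 0%N); exact: normr_ge0.
have AkC k n : `|A n k| <= 2 ^+ k * C.
  elim: k n => [|k IH] n; first by rewrite mul1r.
  rewrite dA exprS -mulrA mulr2n mulrDl mul1r.
  by apply: le_trans (ler_normB _ _) _; apply: lerD.
pose a k := y ^+ k * A 0%N k / k`!%:R; pose b := exp_coeff y.
pose c n := y ^+ n / n`!%:R * A n 0%N.
have a_le k : `|a k| <= C * exp_coeff (2 * y) k.
  rewrite /a /exp_coeff /= !normrM normfV normr_nat (ger0_norm (exprn_ge0 k y0)).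
  rewrite !mulrA ler_wpM2r ?invr_ge0// exprMn mulrA [leRHS]mulrC.
  by rewrite ler_wpM2l ?exprn_ge0// mulrC.
have a_cvg : cvgn (series a).
  apply: normed_cvg; apply: series_le_cvg (a_le) _ => [n|n|].
  - exact: normr_ge0.
  - by rewrite mulr_ge0// exp_coeff_ge0// mulr_ge0.
  - by apply: is_cvg_seriesZ; exact: is_cvg_series_exp_coeff.
have cE n : c n = \sum_(k < n.+1) a k * b (n - k)%N.
  rewrite /c (iterated_difference n 0 dA) mulr_sumr; apply: eq_bigr => k _.
  have kn : (k <= n)%N by rewrite -ltnS.
  rewrite add0n /a /b /exp_coeff /= -(bin_fact kn).
  have -> : y ^+ n = y ^+ k * y ^+ (n - k) by rewrite -exprD subnKC.
  rewrite !natrM !invfM.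
  have : 'C(n, k)%:R != 0 :> R by rewrite pnatr_eq0 -lt0n bin_gt0.
  have : k`!%:R != 0 :> R by rewrite pnatr_eq0 -lt0n fact_gt0.
  have : (n - k)`!%:R != 0 :> R by rewrite pnatr_eq0 -lt0n fact_gt0.
  move=> ? ? ?; by field; repeat (apply/andP; split).
have SE M : series c M = \sum_(k < M) a k * series b (M - k)%N.
  elim: M => [|M IH]; first by rewrite big_ord0 /series /= big_geq.
  have -> : series c M.+1 = series c M + c M by rewrite !seriesEnat /= big_nat_recr.
  rewrite IH cE.
  rewrite big_ord_recr [in RHS]big_ord_recr /= subnn subSn// subnn addrA.
  rewrite -big_split /=; congr (_ + _); last first.
    by rewrite seriesEnat /= big_nat1.
  apply: eq_bigr => k _; rewrite -mulrDr subSn ?(ltnW (ltn_ord k))//.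
  by rewrite !seriesEnat /= big_nat_recr.
(* The tail of e^y after M - k terms is at most e^{2y} / 2^(M - k). The factor 2^k turns the
   coefficients at 2y from [a_le] into coefficients at 4y, whence e^{6y} in total. *)
have err M : `|expR y * series a M - series c M| <= C * expR (6 * y) / 2 ^+ M.
  have -> : series a M = \sum_(k < M) a k by rewrite seriesEord.
  rewrite SE mulr_sumr -sumrB.
  apply: le_trans (ler_norm_sum _ _ _) _.
  apply: le_trans (_ : \sum_(k < M) C * expR (2 * y) / 2 ^+ M * exp_coeff (4 * y) k <= _).
    apply: ler_sum => k _; rewrite mulrC -mulrBr normrM.
    have /andP[r0 r1] := exp_coeff_tail (M - k)%N y0.
    rewrite (ger0_norm r0).
    apply: le_trans (ler_pM _ _ (a_le k) r1) _ => //; rewrite ?normr_ge0//.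
    have kM : (k <= M)%N by exact: ltnW.
    have -> : 2 ^+ M = 2 ^+ (M - k) * 2 ^+ k :> R by rewrite -exprD subnK.
    rewrite /exp_coeff /= (_ : 4 * y = 2 * (2 * y)); last by ring.
    rewrite [(2 * (2 * y)) ^+ k]exprMn le_eqVlt; apply/orP; left; apply/eqP.
    have : k`!%:R != 0 :> R by rewrite pnatr_eq0 -lt0n fact_gt0.
    have : 2 ^+ k != 0 :> R by rewrite expf_neq0.
    have : 2 ^+ (M - k) != 0 :> R by rewrite expf_neq0.
    by move=> ? ? ?; field; repeat (apply/andP; split).
  rewrite -mulr_sumr (_ : 6 * y = 2 * y + 4 * y); last by ring.
  rewrite expRD mulrA [leRHS]mulrAC ler_wpM2l//.
    by rewrite !mulr_ge0// ?expR_ge0// invr_ge0 exprn_ge0.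
  have y40 : 0 <= 4 * y by rewrite mulr_ge0.
  by apply: le_trans (exp_coeff_series_le M y40); rewrite seriesEnat /= big_mkord.
have err0 : (fun M => C * expR (6 * y) / 2 ^+ M) @ \oo --> (0 : R).
  rewrite -(mulr0 (C * expR (6 * y))); apply: cvgMr.
  under eq_fun do rewrite -exprVn.
  by apply: cvg_expr; rewrite ger0_norm ?invr_ge0// invf_lt1// ltr1n.
have diff0 : (fun M => expR y * series a M - series c M) @ \oo --> (0 : R).
  apply: norm_cvg0; apply: squeeze_cvgr err0; last exact: cvg_cst.
  by near=> M; rewrite normr_ge0 err.
have ya : (fun M => expR y * series a M) @ \oo --> expR y * limn (series a).
  exact: cvgMr.
rewrite -/c (_ : series c = (fun M => expR y * series a M) \- 
  (fun M => expR y * series a M - series c M)); last first.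
  by apply/funext => M /=; rewrite opprB addrC subrK.
by rewrite -[X in _ --> X]subr0; exact: cvgB.
Unshelve. all: by end_near. Qed.

End BinomialTransform.

(** * The exponential of lam (K - 1) in terms of the powers of K *)

Section Uniformization.
Variables (R : realType) (T : choiceType) (K : T -> T -> R) (lam : R).
Hypothesis K_ge0 : forall i j, 0 <= K i j.
Hypothesis K_stochastic : forall j, (\esum_(i in [set: T]) (K i j)%:E = 1)%E.

Let KE i j : \bar R := (K i j)%:E.

Let KE_ge0 i j : (0 <= KE i j)%E. Proof. by rewrite lee_fin. Qed.

Definition finite_mass (p : T -> \bar R) :=
  (forall i, (0 <= p i)%E) /\ (\esum_(i in [set: T]) p i < +oo)%E.

Lemma finite_mass_fin p i : finite_mass p -> p i \is a fin_num.
Proof.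
by move=> [p0 pf]; rewrite ge0_fin_numE// (le_lt_trans (esum_ge1 i p0)).
Qed.

Lemma finite_massD p q : finite_mass p -> finite_mass q -> finite_mass (p \+ q)%E.
Proof.
move=> [p0 pf] [q0 qf]; split=> [i|]; first by rewrite adde_ge0.
by rewrite esumD// lte_add_pinfty.
Qed.

Lemma finite_mass_iter n p : finite_mass p -> finite_mass (iter n (eapp KE) p).
Proof.
move=> [p0 pf]; split=> [i|]; first exact: iter_eapp_ge0.
by rewrite esum_iter_eapp.
Qed.

(** [usum] is defined by the positive and negative parts; this admits any decomposition into
    nonnegative summable families. *)
Lemma usumB_ge0 (p q : T -> R) : (forall i, 0 <= p i) -> (forall i, 0 <= q i) ->
  (\esum_(i in [set: T]) (p i)%:E < +oo)%E ->
  (\esum_(i in [set: T]) (q i)%:E < +oo)%E ->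
  usum (fun j => p j - q j) =
  fine (\esum_(i in [set: T]) (p i)%:E)%E - fine (\esum_(i in [set: T]) (q i)%:E)%E.
Proof.
move=> p0 q0 pf qf.
have sm (r : T -> R) : (forall i, 0 <= r i) -> (\esum_(i in [set: T]) (r i)%:E < +oo)%E ->
    summable [set: T] (EFin \o r).
  move=> r0 rf; rewrite /summable (eq_esum (b := EFin \o r))// => i _ /=.
  by rewrite ger0_norm.
have fin (r : T -> R) : (forall i, 0 <= r i) -> (\esum_(i in [set: T]) (r i)%:E < +oo)%E ->
    (\esum_(i in [set: T]) (r i)%:E \is a fin_num)%E.
  by move=> r0 rf; rewrite ge0_fin_numE// esum_ge0// => i _; rewrite lee_fin.
have posE i : ((fun j => p j - q j)^\+ i)%R%:E = ((EFin \o p) \- (EFin \o q))^\+%E i.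
  by rewrite funeposE /= EFin_max.
have negE i : ((fun j => p j - q j)^\- i)%R%:E = ((EFin \o p) \- (EFin \o q))^\-%E i.
  by rewrite funenegE /= EFin_max.
have pos_fin : (\esum_(i in [set: T]) ((fun j => p j - q j)^\+ i)%R%:E < +oo)%E.
  apply: le_lt_trans pf; apply: le_esum => i _; rewrite lee_fin /= ge_max p0 andbT.
  by rewrite lerBlDr lerDl.
have neg_fin : (\esum_(i in [set: T]) ((fun j => p j - q j)^\- i)%R%:E < +oo)%E.
  apply: le_lt_trans qf; apply: le_esum => i _; rewrite lee_fin /= ge_max q0 andbT.
  by rewrite opprB lerBlDr lerDl.
have := esumB (sm _ p0 pf) (sm _ q0 qf) (fun i _ => p0 i) (fun i _ => q0 i).
rewrite /usum; under eq_esum => i _ do rewrite -posE.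
under [X in (_ - X)%E = _ -> _]eq_esum => i _ do rewrite -negE.
have := fin _ (funrpos_ge0 _) pos_fin; have := fin _ (funrneg_ge0 _) neg_fin.
move: (fin _ p0 pf) (fin _ q0 qf).
move: (esum _ _) (esum _ _) (esum _ _) (esum _ _) => a b c d.
by case: a => [a| |]//; case: b => [b| |]//; case: c => [c| |]//; case: d => [d| |]// _ _ _ _ [].
Qed.

Let G i j := lam * (K i j - (i == j)%:R).

(** Because (K - 1)(p - q) = (K p + q) - (K q + p), a signed vector remains a difference of two
    nonnegative ones. The scalar [y] stands for what earlier applications have accumulated. *)
Lemma mxapp_generator (t y : R) (p q : T -> \bar R) i :
  0 <= t * lam -> 0 <= y -> finite_mass p -> finite_mass q ->
  mxapp (fun a b => t * G a b) (fun j => y * (fine (p j) - fine (q j))) i =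
  t * lam * y * (fine (eapp KE p i + q i)%E - fine (eapp KE q i + p i)%E).
Proof.
move=> tl0 y0 mp mq.
have [p0 pf] := mp; have [q0 qf] := mq.
have ty0 : 0 <= t * lam * y by exact: mulr_ge0.
pose P (p q : T -> \bar R) j := t * lam * y * (K i j * fine (p j) + fine (q j) * (j == i)%:R).
have PE (p' q' : T -> \bar R) : finite_mass p' -> finite_mass q' ->
    (\esum_(j in [set: T]) (P p' q' j)%:E = (t * lam * y)%:E * (eapp KE p' i + q' i))%E.
  move=> mp' mq'; have [p'0 _] := mp'; have [q'0 _] := mq'.
  rewrite -(esum_delta i q'0) -esumD => [|j _|j _]; last 2 first.
  - by rewrite mule_ge0.
  - by rewrite mule_ge0// lee_fin.
  rewrite -esumZl ?lee_fin// => [|j]; last by rewrite adde_ge0// mule_ge0// lee_fin.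
  apply: eq_esum => j _; rewrite /P EFinM EFinD !EFinM !fineK//; exact: finite_mass_fin.
have P0 (p' q' : T -> \bar R) j : finite_mass p' -> finite_mass q' -> 0 <= P p' q' j.
  by move=> [p'0 _] [q'0 _]; rewrite /P mulr_ge0// addr_ge0// mulr_ge0// fine_ge0.
have Kfin (p' : T -> \bar R) : finite_mass p' -> eapp KE p' i \is a fin_num.
  by move=> mp'; apply: finite_mass_fin; exact: (finite_mass_iter 1).
have Pfin (p' q' : T -> \bar R) : finite_mass p' -> finite_mass q' ->
    (\esum_(j in [set: T]) (P p' q' j)%:E < +oo)%E.
  move=> mp' mq'; rewrite PE// ltey_eq fin_numM// fin_numD Kfin// finite_mass_fin//.
rewrite /mxapp (_ : (fun j => _) = (fun j => P p q j - P q p j)); last first.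
  by apply/funext => j; rewrite /P /G eq_sym; ring.
rewrite usumB_ge0; [|by move=> j; exact: P0..|exact: Pfin|exact: Pfin].
rewrite !PE// !fineM ?fin_numD ?Kfin ?finite_mass_fin//= .
by rewrite mulrBr.
Qed.

(* The difference of the two components is (K - 1)^k (p - q). *)
Fixpoint difference_pair (p q : T -> \bar R) k : (T -> \bar R) * (T -> \bar R) :=
  if k is k'.+1 then
    let: (p', q') := difference_pair p q k' in
    ((eapp KE p' \+ q')%E, (eapp KE q' \+ p')%E)
  else (p, q).

(** With y = t lam this is e^{y K} = e^y e^{t G}, by the binomial transform applied to a coordinate
    of K^n (K - 1)^k (p - q). *)
Lemma expapp_uniformized (t : R) (p q : T -> \bar R) i :
  0 <= t * lam -> finite_mass p -> finite_mass q ->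
  series (fun n => (t * lam) ^+ n / n`!%:R *
    (fine (iter n (eapp KE) p i) - fine (iter n (eapp KE) q i))) @ \oo -->
  expR (t * lam) * expapp G t (fun j => fine (p j) - fine (q j)) i.
Proof.
move=> tl0 mp mq.
pose pk k := (difference_pair p q k).1; pose qk k := (difference_pair p q k).2.
have pS k : pk k.+1 = (eapp KE (pk k) \+ qk k)%E.
  by rewrite /pk /qk /=; case: difference_pair.
have qS k : qk k.+1 = (eapp KE (qk k) \+ pk k)%E.
  by rewrite /pk /qk /=; case: difference_pair.
have mpq k : finite_mass (pk k) /\ finite_mass (qk k).
  elim: k => [//|k [mpk mqk]]; rewrite pS qS.
  by split; apply: finite_massD => //; exact: (finite_mass_iter 1).
pose A n k := fine (iter n (eapp KE) (pk k) i) - fine (iter n (eapp KE) (qk k) i).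
have dA n k : A n k.+1 = A n.+1 k - A n k.
  have [[p0 pf] [q0 qf]] := mpq k; have [mpk mqk] := mpq k.
  rewrite /A pS qS !iter_eappD//; try exact: eapp_ge0.
  rewrite /= -!iterSr !fineD; try by apply: finite_mass_fin; exact: finite_mass_iter.
  by rewrite !iterS; ring.
have iterE k : iter k (mxapp (fun a b => t * G a b)) (fun j => fine (p j) - fine (q j)) =
    fun j => (t * lam) ^+ k * (fine (pk k j) - fine (qk k j)).
  elim: k => [|k IH]; first by apply/funext => j; rewrite /= mul1r.
  apply/funext => j; rewrite iterS IH mxapp_generator ?exprn_ge0//; try by case: (mpq k).
  by rewrite pS qS exprS.
have AC n : `|A n 0%N| <= fine (\esum_(j in [set: T]) p j)%E + fine (\esum_(j in [set: T]) q j)%E.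
  have bound (r : T -> \bar R) : finite_mass r ->
      `|fine (iter n (eapp KE) r i)| <= fine (\esum_(j in [set: T]) r j)%E.
    move=> mr; have [r0 rf] := mr; have [ir0 _] := finite_mass_iter n mr.
    rewrite ger0_norm ?fine_ge0//; apply: fine_le.
    - by apply: finite_mass_fin; exact: finite_mass_iter.
    - by rewrite ge0_fin_numE// esum_ge0.
    rewrite -(esum_iter_eapp KE_ge0 K_stochastic n r0).
    exact: (esum_ge1 i ir0).
  by apply: le_trans (ler_normB _ _) _; apply: lerD; exact: bound.
have := binomial_transform_exp tl0 dA AC.
rewrite /expapp (_ : (fun k => _ / _) = (fun k => (t * lam) ^+ k * A 0%N k / k`!%:R))//.
by apply/funext => k; rewrite iterE.
Qed.

(** The series of e^{x K} at the unit vector [d] has nonnegative terms, of which those of order 0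
    and 1 are kept; the prefactor e^{-x} is at least 1 - x. *)
Lemma exp_entry_ge (h : R) i j : 0 <= h * lam ->
  (1 - h * lam) * ((i == j)%:R + h * lam * K i j) <= exp_entry G h i j.
Proof.
set x := h * lam => x0.
pose d : T -> \bar R := fun k => (k == j)%:R%:E.
have d0 k : (0 <= d k)%E by rewrite lee_fin.
have md : finite_mass d.
  split => //; rewrite (eq_esum (b := fun k => 1 * (k == j)%:R%:E)%E) => [|k _].
    by rewrite esum_delta// ltry.
  by rewrite mul1e.
have m0 : finite_mass (cst 0%E) by split => //; rewrite esum1.
have := expapp_uniformized (i := i) x0 md m0.
have -> : (fun k => fine (d k) - fine (cst 0%E k)) = (fun k => (k == j)%:R :> R).
  by apply/funext => k; rewrite subr0.
rewrite -/x; set c := (fun n => _) => /cvg_lim cE.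
have iter0 n : iter n (eapp KE) (cst 0%E) i = 0%E.
  elim: n i {cE c} => //= n IH i; rewrite /eapp esum1// => k _.
  by rewrite IH mule0.
have c0 n : 0 <= c n.
  rewrite /c iter0 subr0 mulr_ge0 ?divr_ge0 ?exprn_ge0// fine_ge0//.
  exact: iter_eapp_ge0.
have c01 : (i == j)%:R + x * K i j <= expR x * exp_entry G h i j.
  rewrite /exp_entry -cE//.
  have -> : (i == j)%:R + x * K i j = series c 2.
    rewrite seriesEnat /= !big_nat_recr//= big_nil add0r /c !iter0 !subr0.
    rewrite !expr0 !expr1 !divr1 mul1r /=; congr (_ + x * _).
    rewrite /eapp (eq_esum (b := fun k => KE i k * d k)%E)//.
    by rewrite esum_delta.
  apply: nondecreasing_cvgn_le; last by apply/cvg_ex; eexists; exact: (expapp_uniformized (i := i) x0 md m0).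
  by apply: nondecreasing_series => k _ _.
have ex : expR x * expR (- x) = 1 by rewrite -expRD subrr expR0.
have e1 : 1 - x <= expR (- x) by exact: expR_ge1Dx.
have b0 : 0 <= (i == j)%:R + x * K i j by rewrite addr_ge0// mulr_ge0.
apply: le_trans (_ : expR (- x) * ((i == j)%:R + x * K i j) <= _).
  by rewrite ler_wpM2r.
rewrite [leRHS](_ : _ = expR (- x) * (expR x * exp_entry G h i j)).
  by rewrite ler_wpM2l// expR_ge0.
by rewrite mulrA [expR (- x) * _]mulrC ex mul1r.
Qed.

End Uniformization.

(** * Return times of the continuous-time chain *)

Section MixedSequence.
Variable R : realType.
Implicit Types (x : R) (g : nat -> R).

(* mixed x g N l is ((1 + x D)^N g) l, where D is the shift of sequences. *)
Fixpoint mixed x g N l :=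
  if N is N'.+1 then mixed x g N' l + x * mixed x g N' l.+1 else g l.

Lemma mixed_ge0 x g N l : 0 <= x -> (forall n, 0 <= g n) -> 0 <= mixed x g N l.
Proof. by move=> x0 g0; elim: N l => //= N IH l; rewrite addr_ge0 ?mulr_ge0. Qed.

(* Markov's inequality for the binomial distribution with weights
   'C(N, k) x^k, in inductive form. *)
Lemma mixed_ge x g N l n : 0 <= x -> (forall k, 0 <= g k) ->
  (forall k, g k.+1 <= g k) -> (0 < n)%N ->
  (1 + x) ^+ N * (1 - (l%:R + N%:R * x) / n%:R) * g n <= mixed x g N l.
Proof.
move=> x0 g0 g_dec n0; have n0' : 0 < n%:R :> R by rewrite ltr0n.
have g_le k m : (k <= m)%N -> g m <= g k.
  by move=> /subnK <-; elim: (m - k)%N => //= i; apply: le_trans; exact: g_dec.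
elim: N l => [|N IH] l /=.
  (* For l <= n the monotonicity of [g] suffices; for l > n the left side is at most 0. *)
  rewrite mul1r mul0r addr0; have [ln|ln] := leqP l n.
    apply: le_trans (g_le _ _ ln); rewrite ler_piMl// gerBl divr_ge0//.
  apply: le_trans (g0 l); rewrite mulr_le0_ge0// subr_le0 ler_pdivlMr// mul1r.
  by rewrite ler_nat ltnW.
apply: le_trans (lerD (IH l) (ler_wpM2l x0 (IH l.+1))).
set a := (1 + x) ^+ N; have a0 : 0 <= a by rewrite exprn_ge0// addr_ge0.
have -> : (1 + x) ^+ N.+1 = (1 + x) * a by rewrite exprS.
rewrite -!natr1; set c := (l%:R + N%:R * x) / n%:R.
have -> : (l%:R + (N%:R + 1) * x) / n%:R = c + x / n%:R by rewrite /c; field; rewrite gt_eqF.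
have -> : (l%:R + 1 + N%:R * x) / n%:R = c + n%:R^-1 by rewrite /c; field; rewrite gt_eqF.
(* The two induction hypotheses together exceed the target by a nonnegative term in x^2. *)
have -> : a * (1 - c) * g n + x * (a * (1 - (c + n%:R^-1)) * g n) =
  (1 + x) * a * (1 - (c + x / n%:R)) * g n + a * g n * (x ^+ 2 / n%:R) by field; rewrite gt_eqF.
by rewrite lerDl !mulr_ge0// ?exprn_ge0// invr_ge0 ltW.
Qed.

End MixedSequence.

Lemma bernoulli_le (R : realType) (x : R) n : 0 <= x <= 1 -> 1 - n%:R * x <= (1 - x) ^+ n.
Proof.
move=> /andP[x0 x1]; elim: n => [|n IH]; first by rewrite mul0r subr0.
rewrite exprS -natr1; apply: le_trans (ler_wpM2l _ IH); last by rewrite subr_ge0.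
have : 0 <= n%:R * x ^+ 2 by rewrite mulr_ge0// exprn_ge0.
by nra.
Qed.

Lemma esum_le_measure (R : realType) (I : choiceType) d (T : measurableType d)
    (P : {measure set T -> \bar R}) (F : I -> set T) (E : set T) :
  (forall i, measurable (F i)) -> measurable E -> (forall i, F i `<=` E) ->
  trivIset [set: I] F -> (\esum_(i in [set: I]) P (F i) <= P E)%E.
Proof.
move=> mF mE FE tF; apply: ge_ereal_sup => _ [X [finX _] <-].
have tX : trivIset X F by exact: sub_trivIset tF.
rewrite -measure_fin_bigcup//; apply: le_measure; rewrite ?inE//.
  exact: fin_bigcup_measurable.
by apply: bigcup_sub => i _; exact: FE.
Qed.

(** * Lower bounds for the probability of a late return *)

Section AvoidanceProbability.
Variables (R : realType) (T : choiceType) (K : T -> T -> R) (o : T).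
Hypothesis K_ge0 : forall i j, 0 <= K i j.
Hypothesis K_stochastic : forall j, (\esum_(i in [set: T]) (K i j)%:E = 1)%E.
Variables (d : measure_display) (W : measurableType d) (P : probability W R).
Variables (X : R -> W -> T) (S : R -> T -> T -> R) (lam : R).
Hypothesis lam_gt0 : 0 < lam.
Hypothesis S_ge : forall h i j, 0 <= h * lam ->
  (1 - h * lam) * ((i == j)%:R + h * lam * K i j) <= S h i j.
Hypothesis X_measurable : forall t i, 0 <= t -> measurable [set w | X t w = i].
Hypothesis X_right_continuous : forall w t, 0 <= t ->
  \forall s \near t^'+, X s w = X t w.
Hypothesis X_initial : P [set w | X 0 w = o] = 1%E.

Definition cylinder (hist : seq (R * T)) (s : R) (j : T) : set W :=
  [set w | forall p : R * T, p \in hist -> X p.1 w = p.2] `&` [set w | X s w = j].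

Hypothesis X_markov : forall (hist : seq (R * T)) (s t : R) (i j : T),
  0 <= s -> 0 <= t -> (forall p : R * T, p \in hist -> 0 <= p.1 <= s) ->
  P (cylinder hist s j `&` [set w | X (s + t) w = i]) =
  ((S t i j)%:E * P (cylinder hist s j))%E.

Let KE i j : \bar R := (K i j)%:E.
Let KE_ge0 i j : (0 <= KE i j)%E. Proof. by rewrite lee_fin. Qed.
Let surv n j : R := fine (survival KE o n j).

Let survE n j : survival KE o n j = (surv n j)%:E.
Proof.
rewrite fineK// ge0_fin_numE ?survival_ge0//.
exact: le_lt_trans (survival_le1 o KE_ge0 K_stochastic n j) (ltry _).
Qed.

Let surv_ge0 j n : 0 <= surv n j.
Proof. by rewrite fine_ge0// survival_ge0. Qed.

Let surv_dec j n : surv n.+1 j <= surv n j.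
Proof. by rewrite -lee_fin -!survE; exact: survival_nonincreasing. Qed.

(** Expanded, this is the sum over k of 'C(N, k) x^k [surv (l + k) j]. At l = 0 and multiplied by (1
    - x)^N, it bounds from below the probability of avoiding [o] during [N] grid steps from a state
    other than [o]. *)
Let mixs x N l j := mixed x (surv ^~ j) N l.

Let mixs_ge0 x N l j : 0 <= x -> 0 <= mixs x N l j.
Proof. by move=> x0; exact: mixed_ge0. Qed.

(** One step of the taboo chain raises the survival index of every term of the mixture by one. *)
Let mixsS x N l j : 0 <= x ->
  (\esum_(i in [set: T]) (taboo KE o i j * (mixs x N l i)%:E) = (mixs x N l.+1 j)%:E)%E.
Proof.
move=> x0; elim: N l => [|N IH] l.
  by rewrite /mixs /= -survE survivalS; apply: eq_esum => i _; rewrite survE.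
have t0 i k : (0 <= taboo KE o i k)%E by exact: taboo_ge0.
transitivity (\esum_(i in [set: T]) (taboo KE o i j * (mixs x N l i)%:E +
    x%:E * (taboo KE o i j * (mixs x N l.+1 i)%:E)))%E.
  apply: eq_esum => i _; rewrite /mixs /= EFinD ge0_muleDr ?lee_fin ?mulr_ge0 ?mixed_ge0//.
  by rewrite EFinM muleCA.
have tm l' i : (0 <= taboo KE o i j * (mixs x N l' i)%:E)%E.
  by rewrite mule_ge0// lee_fin mixs_ge0.
rewrite esumD => [|//|i _]; last by rewrite mule_ge0.
by rewrite esumZl// !IH.
Qed.

(** * The chain observed on a grid of mesh h *)

Section Grid.
Variable h : R.
Hypothesis h_ge0 : 0 <= h.
Let x := h * lam.
Hypothesis x_le1 : x <= 1.

Let x_ge0 : 0 <= x. Proof. by rewrite mulr_ge0// ltW. Qed.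

(** The state differs from [o] at the times s + h, ..., s + N h; the time [s] itself is left
    free. *)
Fixpoint avoid N s : set W :=
  if N is N'.+1 then ~` [set w | X (s + h) w = o] `&` avoid N' (s + h) else setT.

Let avoid_measurable N s : 0 <= s -> measurable (avoid N s).
Proof.
elim: N s => //= N IH s s0; apply: measurableI; last by apply: IH; rewrite addr_ge0.
by apply: measurableC; apply: X_measurable; rewrite addr_ge0.
Qed.

Let avoidP N s w : avoid N s w -> forall k, (k < N)%N -> X (s + k.+1%:R * h) w <> o.
Proof.
elim: N s => //= N IH s [Xs /IH{}IH] [_|k kN]; first by rewrite mul1r.
have := IH k kN; congr (~ (X _ w = _)); rewrite -[in RHS]natr1; ring.
Qed.

Let valid s (hist : seq (R * T)) := forall p : R * T, p \in hist -> 0 <= p.1 <= s.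

Let cylinder_measurable hist s j : 0 <= s -> valid s hist -> measurable (cylinder hist s j).
Proof.
move=> s0 vh; apply: measurableI; last exact: X_measurable.
elim: hist vh => [|p hist IH] vh.
  by rewrite (_ : [set _ | _] = setT)//; apply/seteqP; split.
rewrite (_ : [set _ | _] = [set w | X p.1 w = p.2] `&`
    [set w | forall p : R * T, p \in hist -> X p.1 w = p.2]).
  apply: measurableI; last by apply: IH => q qh; apply: vh; rewrite inE qh orbT.
  by apply: X_measurable; case/andP: (vh p (mem_head _ _)).
apply/seteqP; split => w /=.
  by move=> H; split=> [|q qh]; apply: H; rewrite inE ?eqxx// qh orbT.
by move=> [H1 H2] q; rewrite inE => /predU1P[->|/H2].
Qed.

Let cylinder_cons hist s j t i :
  cylinder ((s, j) :: hist) t i = cylinder hist s j `&` [set w | X t w = i].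
Proof.
apply/seteqP; split => w /= [].
  move=> H Xt; split => //; split; last by apply: (H (s, j)); rewrite mem_head.
  by move=> q qh; apply: H; rewrite inE qh orbT.
move=> [H Xs] Xt; split => // q; rewrite inE => /predU1P[->//|]; exact: H.
Qed.

Let valid_cons s j hist : 0 <= s -> valid s hist -> valid (s + h) ((s, j) :: hist).
Proof.
move=> s0 vh q; rewrite inE => /predU1P[->|/vh/andP[q0 qs]] /=.
  by rewrite s0 lerDl.
by rewrite q0 (le_trans qs)// lerDl.
Qed.

(** First step analysis: by [S_ge] the chain stays at [j] with weight 1 or moves along [K] with
    weight [x], up to the factor 1 - x. The case [j = o], where only a move is admissible, serves
    for the departure from [o]; hence the induction hypothesis appears as a premise. *)
Let avoid_step N :
  (forall hist s i, 0 <= s -> valid s hist -> i != o ->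
    (((1 - x) ^+ N * mixs x N 0 i)%:E * P (cylinder hist s i) <=
     P (cylinder hist s i `&` avoid N s))%E) ->
  forall hist s j, 0 <= s -> valid s hist ->
    (((1 - x) ^+ N.+1 * ((j != o)%:R * mixs x N 0 j + x * mixs x N 1 j))%:E *
       P (cylinder hist s j) <= P (cylinder hist s j `&` avoid N.+1 s))%E.
Proof.
move=> IH hist s j s0 vh.
have sh0 : 0 <= s + h by rewrite addr_ge0.
pose F i := if i == o then set0 else
  cylinder ((s, j) :: hist) (s + h) i `&` avoid N (s + h).
have mF i : measurable (F i).
  rewrite /F; case: ifP => // _; apply: measurableI; last exact: avoid_measurable.
  by apply: cylinder_measurable => //; exact: valid_cons.
apply: le_trans (@esum_le_measure _ _ _ _ P F _ mF _ _ _); last 3 first.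
- apply: measurableI; first exact: cylinder_measurable.
  exact: (@avoid_measurable N.+1).
- move=> i w; rewrite /F; case: eqP => // io; rewrite cylinder_cons /=.
  by move=> [[[H1 H2] H3] H4]; split => //; split => //; rewrite H3.
- move=> i k _ _ [w []]; rewrite /F; case: eqP => // _; case: eqP => // _.
  by rewrite !cylinder_cons => -[[_ /= <-] _] [[_ /= <-] _].
have p0 : (0 <= P (cylinder hist s j))%E by exact: measure_ge0.
have x10 : 0 <= (1 - x) by rewrite subr_ge0.
apply: le_trans (_ : (\esum_(i in [set: T])
   (((1 - x) ^+ N.+1)%:E * P (cylinder hist s j) *
    ((j != o)%:R%:E * (mixs x N 0 i)%:E * (i == j)%:R%:E +
     x%:E * (taboo KE o i j * (mixs x N 0 i)%:E))))%E <= _)%E.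
  have m0 l i : (0 <= (mixs x N l i)%:E)%E by rewrite lee_fin mixs_ge0.
  have t0 i k : (0 <= taboo KE o i k)%E by exact: taboo_ge0.
  have j0 i : (0 <= (j != o)%:R%:E * (mixs x N 0 i)%:E)%E by rewrite mule_ge0.
  rewrite esumZl; last 2 first.
  - by rewrite mule_ge0// lee_fin exprn_ge0.
  - by move=> i; rewrite adde_ge0// !mule_ge0.
  rewrite esumD => [|i _|i _]; [|by rewrite !mule_ge0|by rewrite !mule_ge0].
  rewrite esum_delta// esumZl// => [|i]; last by rewrite mule_ge0.
  rewrite mixsS//.
  by rewrite EFinM EFinD !EFinM muleAC.
apply: le_esum => i _; rewrite /F.
have [->{i}|io] := eqVneq i o.
  rewrite /taboo eqxx mul0e mule0 adde0 measure0.
  by have [->|] := eqVneq j o; rewrite /= ?(mul0e, mule0)// => /negbTE jo; rewrite eq_sym jo !mule0.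
apply: le_trans (IH _ _ _ sh0 _ io); last exact: valid_cons.
rewrite cylinder_cons X_markov// [leRHS]muleA [leRHS]muleC [leLHS]muleAC [leLHS]muleC.
apply: lee_wpmul2l => //; rewrite /taboo (negbTE io) -!EFinM lee_fin.
have := S_ge (h := h) i j x_ge0; rewrite -/x => Sij.
rewrite (_ : (j != o)%:R * mixs x N 0 i * (i == j)%:R = mixs x N 0 i * (i == j)%:R); last first.
  by have [<-|_] := eqVneq i j; rewrite ?io ?mul1r// !mulr0.
rewrite exprS.
rewrite [leLHS](_ : _ = (1 - x) ^+ N * mixs x N 0 i * ((1 - x) * ((i == j)%:R + x * K i j))); last by ring.
by rewrite ler_wpM2l// mulr_ge0 ?exprn_ge0// mixs_ge0.
Qed.

Let avoid_ge N hist s i : 0 <= s -> valid s hist -> i != o ->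
  (((1 - x) ^+ N * mixs x N 0 i)%:E * P (cylinder hist s i) <=
   P (cylinder hist s i `&` avoid N s))%E.
Proof.
elim: N hist s i => [|N IH] hist s i s0 vh io.
  rewrite /= setIT mul1r -[leRHS]mul1e; apply: lee_wpmul2r; first exact: measure_ge0.
  by rewrite /mixs /= lee_fin.
by have := avoid_step IH i s0 vh; rewrite io mul1r.
Qed.

(** The history of being at [o] at the grid indices 0, ..., k - 1; [stay k] adds the index [k]. *)
Let zeros k := [seq (a%:R * h, o) | a <- iota 0 k].

Let stay k := cylinder (zeros k) (k%:R * h) o.

Let kh_ge0 k : 0 <= k%:R * h. Proof. by rewrite mulr_ge0. Qed.

Let valid_zeros k : valid (k%:R * h) (zeros k).
Proof.
move=> p /mapP[a]; rewrite mem_iota add0n => /andP[_ ak] -> /=.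
by rewrite kh_ge0 ler_wpM2r// ler_nat ltnW.
Qed.

Let stayP k w : stay k w -> forall a, (a <= k)%N -> X (a%:R * h) w = o.
Proof.
move=> [H Xk] a; rewrite leq_eqVlt => /predU1P[->//|ak].
by apply: (H (a%:R * h, o)); apply/mapP; exists a => //; rewrite mem_iota.
Qed.

(** Each grid step stays at [o] with probability at least 1 - x, by the diagonal case of [S_ge]. *)
Let stay_ge k : (((1 - x) ^+ k)%:E <= P (stay k))%E.
Proof.
elim: k => [|k IH].
  rewrite /stay /cylinder mul0r (_ : [set w | forall p, _] = setT).
    by rewrite setTI X_initial.
  by apply/seteqP; split => // w _ p.
have -> : stay k.+1 = stay k `&` [set w | X (k%:R * h + h) w = o].
  have E : k.+1%:R * h = k%:R * h + h by rewrite -natr1; ring.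
  apply/seteqP; split => w.
    move=> sk; split; last by rewrite /= -E; exact: (stayP sk).
    split; last by apply: (stayP sk).
    move=> p /mapP[a]; rewrite mem_iota add0n => /andP[_ ak] -> /=.
    by apply: (stayP sk); rewrite ltnW// ltnW.
  move=> [sk /= Xk]; split; last by rewrite /= E.
  move=> p /mapP[a]; rewrite mem_iota add0n => /andP[_ ak] -> /=.
  by apply: (stayP sk).
rewrite X_markov//; last exact: valid_zeros.
rewrite exprS EFinM; apply: lee_pmul => //.
- by rewrite lee_fin subr_ge0.
- by rewrite lee_fin exprn_ge0// subr_ge0.
rewrite lee_fin; apply: le_trans (S_ge o o x_ge0); rewrite -/x eqxx.
by rewrite ler_peMr ?subr_ge0// lerDl mulr_ge0.
Qed.

(** No pair of positive grid times up to N h witnesses a return in the sense of [return_time]. *)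
Definition no_return N : set W := [set w | forall a b, (0 < a)%N -> (a < b)%N ->
  (b <= N)%N -> X (a%:R * h) w <> o -> X (b%:R * h) w <> o].

Lemma no_return_measurable N : measurable (no_return N).
Proof.
have -> : no_return N = \bigcap_a \bigcap_b [set w | (0 < a)%N -> (a < b)%N ->
    (b <= N)%N -> X (a%:R * h) w <> o -> X (b%:R * h) w <> o].
  by apply/seteqP; split => [w H a _ b _|w H a b]; [exact: H|exact: (H a I b I)].
apply: bigcapT_measurable => a; apply: bigcapT_measurable => b.
have [abN|abN] := boolP [&& 0 < a, a < b & b <= N]%N.
  have /and3P[a0 ab bN] := abN.
  rewrite (_ : [set _ | _] = [set w | X (a%:R * h) w = o] `|`
      ~` [set w | X (b%:R * h) w = o]).
    apply: measurableU; first exact: X_measurable.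
    by apply: measurableC; exact: X_measurable.
  apply/seteqP; split => w /=.
    by move=> H; have [Xa|Xa] := pselect (X (a%:R * h) w = o); [left|right; exact: H].
  by move=> [Xa _ _ _ /(_ Xa)//|Xb _ _ _ _].
rewrite (_ : [set _ | _] = setT)//; apply/seteqP; split => // w _ a0 ab bN.
by move: abN; rewrite a0 ab bN.
Qed.

(** [Q k] keeps the chain at [o] through the grid index [k] and away from it at the indices k + 1,
    ..., N. The departure must be a move, which gives the factor [x] and the level 1 in [mixs]. *)
Lemma no_return_ge L N : (L <= N)%N ->
  ((\sum_(k < L) (1 - x) ^+ N * (x * mixs x (N - k.+1) 1 o))%:E <= P (no_return N))%E.
Proof.
move=> LN.
pose Q k := if (k < L)%N then stay k `&` avoid (N - k) (k%:R * h) else set0.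
have mQ k : measurable (Q k).
  rewrite /Q; case: ifP => // _; apply: measurableI; last exact: avoid_measurable.
  exact: cylinder_measurable.
apply: le_trans (@esum_le_measure _ _ _ _ P Q _ mQ _ _ _); last 3 first.
- exact: no_return_measurable.
- move=> k w; rewrite /Q; case: ifPn => // kL [sk /avoidP av] a b a0 ab bN Xa.
  have ka : (k < a)%N by rewrite ltnNge; apply/negP => ak; apply: Xa; exact: (stayP sk).
  have kb := ltn_trans ka ab; have := av (b - k.+1)%N.
  rewrite (_ : k%:R * h + _ = b%:R * h); first by apply; lia.
  by rewrite -mulrDl -natrD; congr (_%:R * _); lia.
- have disj k k' w : (k < k')%N -> Q k w -> Q k' w -> False.
    rewrite /Q => kk'; case: ifP => [kL [_ /avoidP av]|_ []].
    case: ifP => [k'L [sk _]|_ []].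
    apply: (av 0%N); first by lia.
    rewrite mul1r (_ : _ + h = k.+1%:R * h); last by rewrite -natr1; ring.
    exact: (stayP sk).
  move=> k k' _ _ [w [Qk Qk']]; have [kk'|kk'|//] := ltngtP k k'.
  - by have := disj _ _ _ kk' Qk Qk'.
  - by have := disj _ _ _ kk' Qk' Qk.
rewrite -nneseries_esumT//.
apply: le_trans (_ : (\sum_(0 <= k < L) P (Q k) <= _)%E); last first.
  by apply: nneseries_lim_ge.
rewrite big_mkord -sumEFin; apply: lee_sum => k _; rewrite /Q ltn_ord.
have [n Nk] : exists n, (N - k = n.+1)%N.
  by exists (N - k.+1)%N; have := ltn_ord k; lia.
rewrite Nk subnS Nk /=.
have := avoid_step (@avoid_ge n) o (kh_ge0 k) (@valid_zeros k).
rewrite eqxx mul0r add0r; apply: le_trans.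
rewrite muleC; apply: le_trans (lee_wpmul2r _ (stay_ge k)); last first.
  have m0 : 0 <= mixs x n 1 o by exact: mixs_ge0.
  have x0 := x_ge0.
  by rewrite lee_fin (mulr_ge0 (exprn_ge0 _ _) (mulr_ge0 _ _))// subr_ge0.
rewrite -EFinM lee_fin [leRHS]mulrA -exprD (_ : (k + n.+1 = N)%N)//.
by rewrite -Nk subnKC// (leq_trans (ltnW (ltn_ord k))).
Qed.

End Grid.

(** * Passage to continuous time along dyadic grids *)

Let delta : R := (2 * lam)^-1.

Let delta_gt0 : 0 < delta. Proof. by rewrite invr_gt0 mulr_gt0. Qed.

Let step m : R := delta / 2 ^+ m.

Let step_gt0 m : 0 < step m. Proof. by rewrite divr_gt0// exprn_gt0. Qed.

(** The choice of [delta] makes [x] times the number 2^m of grid steps per [delta] equal to 1/2. *)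
Let stepE m : step m * lam = (2 * 2 ^+ m)^-1.
Proof.
have : 2 ^+ m != 0 :> R by rewrite expf_neq0.
by move=> u0; rewrite /step /delta; field; rewrite u0 gt_eqF.
Qed.

(* The chain stays at o during the first k < 2 ^ m steps of the grid and avoids o
   afterwards: these events are disjoint. *)
Let no_return_uniform n m : (0 < n)%N -> (n <= m)%N ->
  ((surv n.+2 o / 16)%:E <= P (no_return (step m) (n * 2 ^ m)))%E.
Proof.
move=> n0 nm; have u0 : 0 < 2 ^+ m :> R by rewrite exprn_gt0.
set u : R := 2 ^+ m in u0; have xE : step m * lam = (2 * u)^-1 by exact: stepE.
set x := step m * lam in xE; set s := surv n.+2 o.
have u1 : 1 <= u by rewrite exprn_ege1// ler1n.
have nu : n%:R <= u.
  by rewrite /u -natrX ler_nat (leq_trans nm)// ltnW// ltn_expl.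
have xu : x * u = 2^-1 by rewrite xE; field; rewrite gt_eqF.
have x0 : 0 < x by rewrite xE invr_gt0 mulr_gt0.
have x1 : x <= 1 by rewrite xE invf_le1 ?mulr_gt0//; lra.
apply: le_trans (no_return_ge (ltW (step_gt0 m)) x1 (L := 2 ^ m) (N := n * 2 ^ m) _); last first.
  by rewrite leq_pmull.
rewrite lee_fin -/x.
have s0 : 0 <= s by exact: surv_ge0.
(* There are 2^m terms and 2^m x = 1/2, so 1/8 in each term gives 1/16. *)
apply: le_trans (_ : \sum_(k < 2 ^ m) x * s / 8 <= _).
  by rewrite sumr_const card_ord -[leRHS]mulr_natl natrX -/u; nra.
apply: ler_sum => k _.
have [M NE] : exists M, (n * 2 ^ m = M + k.+1)%N.
  exists (n * 2 ^ m - k.+1)%N; rewrite subnK//.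
  by rewrite (leq_trans (ltn_ord k))// leq_pmull.
rewrite NE addnK.
have Mu : M%:R <= n%:R * u by rewrite /u -natrX -natrM ler_nat NE leq_addr.
have ku : k.+1%:R <= u by rewrite /u -natrX ler_nat.
have := mixed_ge (g := surv ^~ o) M 1 (n := n.+2) (ltW x0) (surv_ge0 o) (surv_dec o) isT.
rewrite -/(mixs x M 1 o) -/s => mixs_ge.
(* M x is at most n/2, and (1 + n/2) / (n + 2) = 1/2; this explains the index n + 2. *)
have coef : 2^-1 <= 1 - (1%:R + M%:R * x) / n.+2%:R.
  have n2E : n.+2%:R = n%:R + 2 :> R by rewrite -natrD addn2.
  rewrite lerBrDl -lerBrDr ler_pdivrMr ?ltr0n// n2E.
  have : M%:R * x <= n%:R * u * x by rewrite ler_pM2r.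
  rewrite -mulrA [u * x]mulrC xu; lra.
have pw1 : 2^-1 <= (1 - x) ^+ k.+1.
  apply: le_trans (bernoulli_le k.+1 _); last by rewrite ltW.
  have : k.+1%:R * x <= u * x by rewrite ler_pM2r.
  by rewrite [u * x]mulrC xu; lra.
(* The factor (1 - x)^M offsets the growth (1 + x)^M of the mixture: M x^2 <= n x / 2 <= 1/4, since
   n <= 2^m. *)
have pw2 : 2^-1 <= ((1 - x) * (1 + x)) ^+ M.
  have -> : (1 - x) * (1 + x) = 1 - x ^+ 2 by ring.
  apply: le_trans (bernoulli_le M _); last by rewrite exprn_ge0 ?exprn_ile1// ltW.
  have : M%:R * x ^+ 2 <= n%:R * u * x ^+ 2 by rewrite ler_pM2r// exprn_gt0.
  have -> : n%:R * u * x ^+ 2 = n%:R * x / 2.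
    by rewrite -xu; ring.
  have : n%:R * x <= u * x by rewrite ler_pM2r.
  by rewrite [u * x]mulrC xu; lra.
apply: le_trans (_ : (1 - x) ^+ (M + k.+1) *
    (x * ((1 + x) ^+ M * (1 - (1%:R + M%:R * x) / n.+2%:R) * s)) <= _); last first.
  by rewrite ler_wpM2l ?exprn_ge0 ?subr_ge0// ler_wpM2l// ltW.
move: coef; set c := 1 - _ => coef.
rewrite [leRHS](_ : _ = (1 - x) ^+ k.+1 * ((1 - x) * (1 + x)) ^+ M * c * (x * s)).
  rewrite [leLHS](_ : _ = 2^-1 * 2^-1 * 2^-1 * (x * s)); last by field.
  apply: ler_wpM2r; first by rewrite mulr_ge0// ltW.
  by apply: ler_pM => //; apply: ler_pM.
by rewrite exprD exprMn; ring.
Qed.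

Let no_return_limit n : set W := \bigcap_m no_return (step m) (n * 2 ^ m).

Let no_return_limit_measurable n : measurable (no_return_limit n).
Proof.
by apply: bigcapT_measurable => m; apply: no_return_measurable; rewrite ltW.
Qed.

(** The grids are nested, so the events decrease in [m], and continuity from above carries the
    bound, uniform in m >= n, to the limit. *)
Let no_return_limit_ge n : (0 < n)%N ->
  ((surv n.+2 o / 16)%:E <= P (no_return_limit n))%E.
Proof.
move=> n0; pose F m := no_return (step m) (n * 2 ^ m).
have mF m : measurable (F m) by apply: no_return_measurable; rewrite ltW.
have F_dec : nonincreasing_seq F.
  apply/nonincreasing_seqP => m; apply/subsetPset => w Fw a b a0 ab bN.
  have stepS c : (c%:R * step m = (2 * c)%:R * step m.+1)%R.
    by rewrite /step exprS natrM; field; rewrite expf_neq0.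
  by rewrite !stepS; apply: Fw; rewrite ?expnS; lia.
have F_cvg : P \o F @ \oo --> P (\bigcap_m F m).
  by apply: nonincreasing_cvg_mu => //;
    [rewrite (le_lt_trans (probability_le1 P (mF _)))// ltry|exact: bigcapT_measurable].
rewrite -(cvg_lim _ F_cvg)//; apply: lime_ge.
  by apply/cvg_ex; eexists; exact: F_cvg.
by exists n => // m nm; exact: no_return_uniform.
Qed.

(** If a return occurred before n delta, then on a fine grid the points just after [tau] and just
    after the return would carry the same states by right-continuity, against the event. *)
Let return_time_ge n w : no_return_limit n w ->
  ((n%:R * delta)%:E <= return_time X o w)%E.
Proof.
move=> Gw; apply: le_ereal_inf_tmp => _ [t [t0 [Xt [tau [/andP[tau0 taut] Xtau]]]] <-].
rewrite lee_fin leNgt; apply/negP => tn.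
have [e /= e0 he] := X_right_continuous w (ltW tau0).
have [e' /= e'0 he'] := X_right_continuous w (ltW t0).
pose r := Num.min (Num.min e e') (Num.min (t - tau) (n%:R * delta - t)).
have r0 : 0 < r by rewrite !lt_min e0 e'0 !subr_gt0 taut.
have [m hm] : exists m, step m < r.
  have : step @ \oo --> (0 : R).
    rewrite -(mulr0 delta); apply: cvgMr; under eq_fun do rewrite -exprVn.
    by apply: cvg_expr; rewrite ger0_norm ?invr_ge0// invf_lt1// ltr1n.
  move=> /cvgrPdist_lt /(_ _ r0) [m _ /(_ m (leqnn m))].
  by rewrite sub0r normrN ger0_norm ?ltW// => ?; exists m.
move: hm; rewrite !lt_min => /andP[/andP[he_m he'_m] /andP[htt htn]].
(* The first grid point strictly after [z], since right neighbourhoods leave out the point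
   itself. *)
have grid z : 0 <= z -> exists2 a, (0 < a)%N & z < a%:R * step m <= z + step m.
  move=> z0; have q0 : 0 <= z / step m by rewrite divr_ge0// ltW.
  have /andP[q1 q2] := truncn_itv q0; exists (Num.truncn (z / step m)).+1 => //.
  rewrite -ltr_pdivrMr// q2/= -natr1 mulrDl mul1r lerD2r.
  by rewrite -ler_pdivlMr.
have [a a0 /andP[a1 a2]] := grid _ (ltW tau0).
have [b b0 /andP[b1 b2]] := grid _ (ltW t0).
apply: (Gw m I a b a0).
- by rewrite -(ltr_nat R) -(ltr_pM2r (step_gt0 m)); lra.
- rewrite -(ler_nat R) -(ler_pM2r (step_gt0 m)) natrM natrX.
  have -> : n%:R * 2 ^+ m * step m = n%:R * delta.
    by rewrite /step; field; rewrite expf_neq0.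
  by lra.
- rewrite he//= distrC ger0_norm; last by rewrite subr_ge0 ltW.
  by lra.
- rewrite he'//= distrC ger0_norm; last by rewrite subr_ge0 ltW.
  by lra.
Qed.

(* The integral of the return time is bounded below through the simple functions
   below it, since monotonicity of the integral would require measurability. *)
Lemma survival_summable : (\int[P]_w return_time X o w < +oo)%E ->
  (\esum_(n in [set: nat]) survival KE o n o < +oo)%E.
Proof.
move=> int_fin.
have rt0 w : (0 <= return_time X o w)%E.
  by apply: le_ereal_inf_tmp => _ [t [t0 _] <-]; rewrite lee_fin ltW.
pose mean := (\int[P]_w return_time X o w)%E.
have mean0 : (0 <= mean)%E by exact: integral_ge0.
have mean_fin : mean \is a fin_num by rewrite ge0_fin_numE.
have sum_le M : \sum_(n < M) surv n.+3 o <= 16 / delta * fine mean.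
  rewrite mulrAC ler_pdivlMr// mulrC -ler_pdivrMl// -lee_fin fineK//.
  pose g n : W -> \bar R := fun w => (delta%:E * (\1_(no_return_limit n.+1) w)%:E)%E.
  pose f w := (\sum_(n < M) g n w)%E.
  have f0 w : (0 <= f w)%E by apply: sume_ge0 => n _; rewrite mule_ge0// lee_fin ltW.
  have mf n : measurable_fun [set: W] (g n).
    by apply: measurable_funeM; apply/measurable_EFinP; exact: measurable_indic.
  have intf : (\int[P]_w f w = \sum_(n < M) delta%:E * P (no_return_limit n.+1))%E.
    rewrite ge0_integral_sum// => [|n w _]; last by rewrite mule_ge0// lee_fin ltW.
    apply: eq_bigr => n _; rewrite ge0_integralZl_EFin//; last first.
    - exact: ltW.
    - by apply/measurable_EFinP; exact: measurable_indic.
    by rewrite integral_indic// setIT.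
  apply: le_trans (_ : (\int[P]_w f w <= _)%E).
    rewrite intf mulr_sumr mulr_sumr -sumEFin; apply: lee_sum => n _.
    apply: le_trans (lee_wpmul2l _ (no_return_limit_ge (ltn0Sn n))).
      by rewrite -EFinM lee_fin le_eqVlt; apply/orP; left; apply/eqP; field.
    by rewrite lee_fin ltW.
  (* The events decrease in [n]: if the one of index k + 1 holds, so do all earlier ones, and the
     return time is at least (k + 1) delta. *)
  have f_le w : (f w <= return_time X o w)%E.
    have fk k : (\sum_(n < k) g n w <= return_time X o w)%E.
      have sub n' n : (n <= n')%N -> no_return_limit n' w -> no_return_limit n w.
        move=> nn' H m _ a b a0 ab bN; apply: (H m I) => //.
        by rewrite (leq_trans bN)// leq_mul2r nn' orbT.
      elim: k => [|k IH]; first by rewrite big_ord0.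
      have [Gk|nGk] := pselect (no_return_limit k.+1 w).
        apply: le_trans (return_time_ge Gk).
        rewrite (eq_bigr (fun=> delta%:E)) => [|n _].
          by rewrite sumEFin lee_fin sumr_const card_ord mulr_natl.
        by rewrite /g indicE mem_set ?mule1//; apply: sub Gk; exact: ltn_ord.
      by rewrite big_ord_recr /= {2}/g indicE memNset// mule0 adde0.
    exact: fk.
  rewrite /mean !ge0_integralTE//; apply: ereal_sup_le => _ [k kf <-].
  by exists k => // w; exact: le_trans (kf w) (f_le w).
rewrite -nneseries_esumT; last by move=> n; exact: survival_ge0.
(* The 3 accounts for the survival terms of index 0, 1, 2; [sum_le] starts at index 3. *)
apply: le_lt_trans (ltry (3 + 16 / delta * fine mean)).
apply: lime_le; first by apply: is_cvg_nneseries => n _ _; exact: survival_ge0.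
exists 3%N => // M /= M3; under eq_bigr do rewrite survE.
rewrite sumEFin lee_fin big_mkord -(subnKC M3) big_split_ord /=.
apply: lerD; last exact: sum_le.
apply: le_trans (_ : \sum_(i < 3) 1 <= _); last by rewrite sumr_const card_ord.
by apply: ler_sum => i _; rewrite -lee_fin -survE; exact: survival_le1.
Qed.

End AvoidanceProbability.

(** * Poisson averages *)

Lemma norm_cvg_series_le (R : realType) (f : nat -> R) (l : R) :
  series f @ \oo --> l -> (`|l|%:E <= \esum_(n in [set: nat]) `|f n|%:E)%E.
Proof.
move=> fl; have f0 n : (0 <= `|f n|%:E)%E by rewrite lee_fin.
have cvgE : (EFin \o (fun n => `|series f n|)) @ \oo --> `|l|%:E.
  by apply: cvg_EFin; [exact: nearW|exact: cvg_norm].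
rewrite -(cvg_lim _ cvgE)//; apply: lime_le; first by apply/cvg_ex; eexists; exact: cvgE.
apply: nearW => n /=; rewrite -nneseries_esumT//.
apply: le_trans (nneseries_lim_ge n _); last by [].
by rewrite sumEFin lee_fin seriesEnat /=; exact: ler_norm_sum.
Qed.

Lemma esum_exp_coeff_le (R : realType) (y : R) : 0 <= y ->
  (\esum_(n in [set: nat]) (exp_coeff y n)%:E <= (expR y)%:E)%E.
Proof.
move=> y0; have c0 n : (0 <= (exp_coeff y n)%:E)%E by rewrite lee_fin exp_coeff_ge0.
rewrite -nneseries_esumT//; apply: lime_le; first exact: is_cvg_nneseries.
apply: nearW => n; rewrite sumEFin lee_fin.
by have := exp_coeff_series_le n y0; rewrite seriesEnat.
Qed.

(** The n-th term is (n + 1) / y times the next one, which is at most e^y: for fixed [n] the Poisson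
    weight is O(1 / y). *)
Lemma exp_coeff_le_expR (R : realType) (y : R) n : 0 < y ->
  exp_coeff y n <= n.+1%:R / y * expR y.
Proof.
move=> y0; have := expR_ge1Dxn n (ltW y0).
move=> H; apply: le_trans (_ : n.+1%:R / y * (y ^+ n.+1 / n.+1`!%:R) <= _).
  rewrite le_eqVlt; apply/orP; left; apply/eqP.
  rewrite /exp_coeff /= factS natrM exprS.
  have : n`!%:R != 0 :> R by rewrite pnatr_eq0 -lt0n fact_gt0.
  have : n.+1%:R != 0 :> R by rewrite pnatr_eq0.
  move: (n.+1%:R) (n`!%:R) => a b a0 b0; field.
  by rewrite a0 b0 gt_eqF.
rewrite ler_wpM2l// ?divr_ge0 ?(ltW y0)//.
by apply: le_trans H; rewrite lerDr.
Qed.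

(** Finitely many terms have vanishing total Poisson weight and all others are small. Both sides
    carry the factor e^y in place of a normalization. *)
Lemma poisson_average_cvg (R : realType) (D : nat -> \bar R) (C : R) :
  (forall n, 0 <= D n)%E -> (forall n, D n <= C%:E)%E ->
  (forall e : R, 0 < e -> exists N, forall n, (N <= n)%N -> (D n <= e%:E)%E) ->
  forall e : R, 0 < e -> exists2 y0 : R, 0 < y0 & forall y, y0 <= y ->
    (\esum_(n in [set: nat]) ((exp_coeff y n)%:E * D n) <= (e * expR y)%:E)%E.
Proof.
move=> D0 DC Dcvg e e0; have C0 : 0 <= C by rewrite -lee_fin (le_trans (D0 0%N)).
have e20 : 0 < e / 2 by rewrite divr_gt0.
have [N hN] := Dcvg _ e20.
(* Each of the [N] head terms is at most (N / y) e^y C, so they add up to at most (e / 2) e^y; the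
   summand 1 keeps the threshold positive. *)
exists (N%:R * (N%:R * C) / (e / 2) + 1).
  by rewrite ltr_wpDl// divr_ge0 ?mulr_ge0// ltW.
move=> y yy0.
have y1 : N%:R * (N%:R * C) / (e / 2) <= y by apply: le_trans yy0; rewrite lerDl.
have y0 : 0 < y.
  by apply: lt_le_trans yy0; rewrite ltr_wpDl// divr_ge0 ?mulr_ge0// ltW.
have ec0 n : (0 <= (exp_coeff y n)%:E)%E by rewrite lee_fin exp_coeff_ge0// ltW.
pose head n : \bar R := if (n < N)%N then (exp_coeff y n * C)%:E else 0%E.
have head0 n : (0 <= head n)%E.
  by rewrite /head; case: ifP => // _; rewrite lee_fin mulr_ge0// exp_coeff_ge0// ltW.
apply: le_trans (_ : (\esum_(n in [set: nat]) ((e / 2)%:E * (exp_coeff y n)%:E + head n) <= _)%E).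
  apply: le_esum => n _; rewrite /head; have [nN|Nn] := ltnP n N.
    apply: le_trans (lee_wpmul2l (ec0 n) (DC n)) _.
    by rewrite -EFinM leeDr// mule_ge0// lee_fin ltW.
  by rewrite adde0 muleC lee_wpmul2r// hN.
rewrite esumD => [|n _|//]; last by rewrite mule_ge0// lee_fin ltW.
rewrite esumZl// ?lee_fin ?(ltW e20)//.
rewrite (_ : (e * expR y)%:E = (e / 2)%:E * (expR y)%:E + (e / 2 * expR y)%:E)%E; last first.
  by rewrite -EFinM -EFinD; congr _%:E; field.
apply: leeD; first by apply: lee_wpmul2l; rewrite ?lee_fin ?(ltW e20)// esum_exp_coeff_le// ltW.
apply: le_trans (_ : ((\sum_(n < N) N%:R / y * expR y * C)%:E <= _)%E).
  rewrite -nneseries_esumT// (nneseries_split 0 N)// add0n.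
  rewrite [X in (_ + X)%E]eseries0 => [|n Nn _]; last by rewrite /head ltnNge Nn.
  rewrite adde0 big_mkord -sumEFin; apply: lee_sum => n _.
  rewrite /head ltn_ord lee_fin ler_wpM2r//; apply: le_trans (exp_coeff_le_expR n y0) _.
  by rewrite ler_wpM2r ?expR_ge0// ler_wpM2r ?invr_ge0 ?(ltW y0)// ler_nat.
rewrite sumr_const card_ord lee_fin -[leLHS]mulr_natl.
rewrite (_ : N%:R * _ = N%:R * (N%:R * C) / y * expR y); last by ring.
by rewrite ler_wpM2r ?expR_ge0// ler_pdivrMr// [leRHS]mulrC -ler_pdivrMr.
Qed.

(** * From convergence of the powers to convergence of the exponential *)

Section ExponentialLimit.
Variables (R : realType) (T : choiceType) (K : T -> T -> R) (lam : R).
Hypothesis K_ge0 : forall i j, 0 <= K i j.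
Hypothesis K_stochastic : forall j, (\esum_(i in [set: T]) (K i j)%:E = 1)%E.
Hypothesis lam_gt0 : 0 < lam.

Let KE i j : \bar R := (K i j)%:E.
Let KE_ge0 i j : (0 <= KE i j)%E. Proof. by rewrite lee_fin. Qed.

(** Poisson weights sum to 1, so with X = p - q and Y = v - w the difference of the exponential at X
    and Y is the Poisson average of K^n X - Y. *)
Lemma expapp_cvg (p q v w : T -> \bar R) :
  finite_mass p -> finite_mass q -> finite_mass v -> finite_mass w ->
  (forall e : R, 0 < e -> exists N, forall n, (N <= n)%N ->
    (\esum_(i in [set: T]) `|iter n (eapp KE) p i - v i| <= e%:E)%E) ->
  (forall e : R, 0 < e -> exists N, forall n, (N <= n)%N ->
    (\esum_(i in [set: T]) `|iter n (eapp KE) q i - w i| <= e%:E)%E) ->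
  forall e : R, 0 < e -> exists t0 : R, forall t, t0 <= t ->
    (l1norm (fun i => expapp (fun i j => lam * (K i j - (i == j)%:R)) t
       (fun j => fine (p j) - fine (q j)) i - (fine (v i) - fine (w i)))%R <= e%:E)%E.
Proof.
move=> mp mq mv mw pv qw e e0.
have abs0 (a : T -> \bar R) i : (0 <= `|a i|)%E by exact: abse_ge0.
pose Dp n := (\esum_(i in [set: T]) `|iter n (eapp KE) p i - v i|)%E.
pose Dq n := (\esum_(i in [set: T]) `|iter n (eapp KE) q i - w i|)%E.
have D0 n : (0 <= Dp n + Dq n)%E by rewrite adde_ge0// esum_ge0.
have D_le (a b : T -> \bar R) n : finite_mass a -> finite_mass b ->
    (\esum_(i in [set: T]) `|iter n (eapp KE) a i - b i| <=
     (fine (\esum_(i in [set: T]) a i) + fine (\esum_(i in [set: T]) b i))%:E)%E.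
  move=> [a0 af] [b0 bf]; have ia0 i : (0 <= iter n (eapp KE) a i)%E.
    exact: iter_eapp_ge0.
  rewrite EFinD !fineK ?ge0_fin_numE ?esum_ge0//.
  rewrite -(esum_iter_eapp KE_ge0 K_stochastic n a0) -esumD//.
  apply: le_esum => i _; apply: le_trans (lee_abs_sub _ _) _.
  by rewrite !gee0_abs.
have D_bounded n := leeD (D_le p v n mp mv) (D_le q w n mq mw).
have D_cvg e' : 0 < e' -> exists N, forall n, (N <= n)%N -> (Dp n + Dq n <= e'%:E)%E.
  move=> e'0; have e'20 : 0 < e' / 2 by rewrite divr_gt0.
  have [N hN] := pv _ e'20; have [N' hN'] := qw _ e'20.
  exists (maxn N N') => n; rewrite geq_max => /andP[/hN np /hN' nq].
  by rewrite [e']splitr EFinD; exact: leeD.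
have [y0 y0_gt0 hy] := poisson_average_cvg D0 D_bounded D_cvg e0.
exists (y0 / lam) => t ty.
have yt : y0 <= t * lam by rewrite -ler_pdivrMr.
set y := t * lam in yt; have y_ge0 : 0 <= y by apply: le_trans yt; exact: ltW.
have ec0 n : (0 <= (exp_coeff y n)%:E)%E by rewrite lee_fin exp_coeff_ge0.
set z := fun i => _ - (fine (v i) - fine (w i)).
have z_le i : ((expR y)%:E * `|z i|%:E <= \esum_(n in [set: nat]) ((exp_coeff y n)%:E *
    (`|iter n (eapp KE) p i - v i| + `|iter n (eapp KE) q i - w i|)))%E.
  rewrite -EFinM -(ger0_norm (expR_ge0 y)) -normrM mulrBr.
  have c1 := expapp_uniformized K_ge0 K_stochastic (i := i) y_ge0 mp mq.
  have c2 : series (fun n => exp_coeff y n * (fine (v i) - fine (w i))) @ \oo -->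
      expR y * (fine (v i) - fine (w i)).
    rewrite (_ : series _ = fun n => series (exp_coeff y) n * (fine (v i) - fine (w i))).
      by apply: cvgMl; exact: is_cvg_series_exp_coeff.
    by apply/funext => n; rewrite !seriesEnat /= mulr_suml.
  pose f n := exp_coeff y n * ((fine (iter n (eapp KE) p i) - fine (v i)) -
    (fine (iter n (eapp KE) q i) - fine (w i))).
  have c3 : series f @ \oo --> expR y * expapp (fun i j => lam * (K i j - (i == j)%:R)) t
      (fun j => fine (p j) - fine (q j)) i - expR y * (fine (v i) - fine (w i)).
    rewrite (_ : series f = series (fun n => y ^+ n / n`!%:R *
        (fine (iter n (eapp KE) p i) - fine (iter n (eapp KE) q i))) -
        series (fun n => exp_coeff y n * (fine (v i) - fine (w i)))).
      exact: cvgB c1 c2.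
    apply/funext => n; rewrite !fctE !seriesEnat /= -sumrB; apply: eq_bigr => k _.
    by rewrite /f /exp_coeff /=; ring.
  apply: le_trans (norm_cvg_series_le c3) _; apply: le_esum => n _.
  rewrite normrM EFinM ger0_norm ?exp_coeff_ge0//; apply: lee_wpmul2l => //.
  have fp : iter n (eapp KE) p i \is a fin_num.
    exact: (finite_mass_fin i (finite_mass_iter K_ge0 K_stochastic n _)).
  have fq : iter n (eapp KE) q i \is a fin_num.
    exact: (finite_mass_fin i (finite_mass_iter K_ge0 K_stochastic n _)).
  rewrite -(fineK fp) -(fineK fq).
  rewrite -(fineK (finite_mass_fin i mv)) -(fineK (finite_mass_fin i mw)) /=.
  by rewrite lee_fin ler_normB.
rewrite -(lee_pmul2l (x := (expR y)%:E))// ?lte_fin ?expR_gt0//.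
rewrite -EFinM mulrC; apply: le_trans (hy y yt).
rewrite /l1norm -esumZl ?lee_fin ?expR_ge0//.
apply: le_trans (le_esum (fun i _ => z_le i)) _.
rewrite exchange_esum => [|i n]; last by rewrite mule_ge0// adde_ge0.
apply: le_esum => n _; rewrite esumZl// => [|i]; last by rewrite adde_ge0.
by rewrite esumD.
Qed.

End ExponentialLimit.

(** * The uniformized generator *)

Section UniformizedMatrix.
Variables (R : realType) (Omega : choiceType) (g : Omega -> Omega -> R).
Hypothesis g_ge0 : forall i j, 0 <= g i j.
Hypothesis g_diag : forall i, g i i = 0.
Hypothesis Gamma_summable :
  (\esum_(p in [set: Omega * Omega]) `|generator g p.1 p.2|%:E < +oo)%E.

(** The summand 1 makes the rate strictly larger than every entry, so that [uniformized] has a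
    positive diagonal. *)
Definition uniform_rate : R :=
  1 + fine (\esum_(p in [set: Omega * Omega]) `|generator g p.1 p.2|%:E)%E.

(** K = 1 + Gamma / lam, written in terms of the rates. *)
Definition uniformized (i j : Omega) : R :=
  (i == j)%:R * (1 - usum (g j) / uniform_rate) + g j i / uniform_rate.

Let abs_ge0 (p : Omega * Omega) : (0 <= `|generator g p.1 p.2|%:E)%E.
Proof. by rewrite lee_fin. Qed.

Lemma uniform_rate_gt0 : 0 < uniform_rate.
Proof. by rewrite ltr_pwDl// fine_ge0// esum_ge0. Qed.

Let entry_lt i j : `|generator g i j| < uniform_rate.
Proof.
rewrite /uniform_rate; set s := esum _ _.
have sfin : s \is a fin_num by rewrite ge0_fin_numE// esum_ge0.
apply: (@le_lt_trans _ _ (fine s)); last by rewrite ltrDr.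
by rewrite -lee_fin fineK//; exact: (esum_ge1 (i, j) abs_ge0).
Qed.

(** The rates out of [j] are dominated by column [j] of the generator, so they are summable and
    [usum] is their genuine sum, not a default value. *)
Let exit_esum j : (\esum_(i in [set: Omega]) (g j i)%:E = (usum (g j))%:E)%E.
Proof.
have col_fin : (\esum_(i in [set: Omega]) (g j i)%:E < +oo)%E.
  apply: le_lt_trans Gamma_summable.
  apply: le_trans (_ : (\esum_(i in [set: Omega]) `|generator g i j|%:E <= _)%E).
    apply: le_esum => i _; rewrite lee_fin /generator.
    by have [->|_] := eqVneq i j; rewrite ?g_diag// ler_norm.
  have inj : set_inj [set: Omega] (fun i => (i, j)) by move=> i k _ _ [].
  pose a p : \bar R := `|generator g p.1 p.2|%:E.
  rewrite -[X in (X <= _)%E](esum_image _ _ a inj).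
  exact: subset_esum.
have := usumB_ge0 (g_ge0 j) (q := fun=> 0) (fun=> lexx 0) col_fin _.
rewrite esum1// => /(_ (ltry 0)).
have -> : (fun i => g j i - 0) = g j by apply/funext => i; rewrite subr0.
by move=> ->; rewrite subr0 fineK// ge0_fin_numE// esum_ge0// => i _; rewrite lee_fin.
Qed.

Let exit_lt j : 0 < 1 - usum (g j) / uniform_rate.
Proof.
rewrite subr_gt0 ltr_pdivrMr ?uniform_rate_gt0// mul1r.
by have := entry_lt j j; rewrite /generator eqxx normrN; apply: le_lt_trans; exact: ler_norm.
Qed.

Lemma uniformized_ge0 i j : 0 <= uniformized i j.
Proof.
apply: addr_ge0; first by apply: mulr_ge0 => //; exact: ltW.
by apply: divr_ge0 => //; apply/ltW/uniform_rate_gt0.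
Qed.

Lemma uniformized_diag_gt0 j : 0 < uniformized j j.
Proof. by rewrite /uniformized eqxx mul1r g_diag mul0r addr0; exact: exit_lt. Qed.

Lemma uniformized_gt0 i j : 0 < g j i -> 0 < uniformized i j.
Proof.
move=> gji; apply: ltr_wpDl; first by apply: mulr_ge0 => //; exact: ltW.
by apply: divr_gt0 => //; exact: uniform_rate_gt0.
Qed.

Lemma uniformized_stochastic j :
  (\esum_(i in [set: Omega]) (uniformized i j)%:E = 1)%E.
Proof.
set q := usum (g j) / uniform_rate.
have l0 : 0 <= uniform_rate^-1 by rewrite invr_ge0 ltW ?uniform_rate_gt0.
have q1 : 0 <= 1 - q by rewrite ltW ?exit_lt.
transitivity (\esum_(i in [set: Omega]) ((1 - q)%:E * (i == j)%:R%:E +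
    uniform_rate^-1%:E * (g j i)%:E))%E.
  apply: eq_esum => i _; rewrite /uniformized -/q EFinD !EFinM.
  by rewrite muleC [X in (_ + X)%E = _]muleC.
have g0 i : (0 <= (g j i)%:E)%E by rewrite lee_fin.
rewrite esumD => [|i _|i _]; [|by apply: mule_ge0; rewrite lee_fin..].
rewrite (esum_delta (f := fun=> (1 - q)%:E)); last by move=> ?; rewrite lee_fin.
rewrite esumZl ?lee_fin// exit_esum -EFinM -EFinD.
by rewrite [_^-1 * _]mulrC -/q subrK.
Qed.

Lemma generator_uniformized :
  generator g = fun i j => uniform_rate * (uniformized i j - (i == j)%:R).
Proof.
have l0 : uniform_rate != 0 by rewrite gt_eqF ?uniform_rate_gt0.
apply/funext => i; apply/funext => j; rewrite /generator /uniformized.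
have [->|_] := eqVneq i j; last by rewrite mul0r add0r subr0 mulrC divfK.
by rewrite g_diag mul0r addr0 mul1r addrC addKr mulrN mulrC divfK.
Qed.

Lemma uniformized_connected : irreducible_rates g -> forall i j : Omega,
  exists p, path (fun a b => (0 < (uniformized b a)%:E)%E) i p /\ last i p = j.
Proof.
move=> irr i j; have [p [pp lp]] := irr i j; exists p; split => //.
by apply: sub_path pp => a b gab; rewrite lte_fin; exact: uniformized_gt0.
Qed.

End UniformizedMatrix.

(** * Convergence of the semigroup in l^1 *)

Theorem theorem16 (R : realType) (Omega : countType)
  (Omega_infinite : infinite_set [set: Omega])
  (g : Omega -> Omega -> R)
  (g_ge0 : forall i j, 0 <= g i j)
  (g_diag : forall i, g i i = 0)
  (Gamma_summable :
    (\esum_(p in [set: Omega * Omega]) `|generator g p.1 p.2|%:E < +oo)%E)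
  (g_irreducible : irreducible_rates g)
  (g_posrec : positive_recurrent g)
  (X0 : Omega -> R) (X0_l1 : in_l1 X0) :
  exists2 Y : Omega -> R, in_l1 Y &
    l1norm (fun i => expapp (generator g) t X0 i - Y i) @[t --> +oo%R] --> 0%E.
Proof.
have [ o _] : [set: Omega] !=set0.
  by apply/set0P/eqP => E; apply: Omega_infinite; rewrite E; exact: finite_set0.
pose lam := uniform_rate g; pose K := uniformized g.
pose KE i j : \bar R := (K i j)%:E.
have lam0 : 0 < lam by exact: uniform_rate_gt0.
have K0 : forall i j, 0 <= K i j by exact: uniformized_ge0.
have KE0 i j : (0 <= KE i j)%E by rewrite lee_fin.
have K1 : forall j, (\esum_(i in [set: Omega]) (K i j)%:E = 1)%E.
  exact: uniformized_stochastic.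
have [d [W [P [X [[Xm Xrc X_init Xmarkov] _ int_fin]]]]] := g_posrec o.
have S_ge h i j : 0 <= h * lam ->
    (1 - h * lam) * ((i == j)%:R + h * lam * K i j) <= exp_entry (generator g) h i j.
  by move=> hl0; rewrite generator_uniformized//; exact: exp_entry_ge.
have surv_fin := survival_summable K0 K1 lam0 S_ge Xm Xrc X_init Xmarkov int_fin.
have [pi [pi0 pio pi_fin Kpi]] := exists_invariant KE0 K1 surv_fin.
pose m := fine (\esum_(i in [set: Omega]) pi i)%E.
have mE : (\esum_(i in [set: Omega]) pi i = m%:E)%E.
  by rewrite fineK// ge0_fin_numE// esum_ge0.
have m0 : 0 < m.
  by rewrite -lte_fin -mE; apply: lt_le_trans (esum_ge1 o pi0); rewrite pio lte_fin.
have pio_gt0 : (0 < pi o)%E by rewrite pio lte_fin.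
have K_diag j : (0 < KE j j)%E by rewrite lte_fin; exact: uniformized_diag_gt0.
have K_conn : forall i j, exists p, path (fun a b => 0 < KE b a)%E i p /\ last i p = j.
  exact: uniformized_connected.
(* The limit is the multiple of [pi] with the mass of [a]; being invariant, it is a constant
   sequence with which the iterates of [a] merge. *)
have limit_of (a : Omega -> \bar R) : finite_mass a -> exists2 v : Omega -> \bar R,
    finite_mass v & forall e : R, 0 < e -> exists N, forall n, (N <= n)%N ->
      (\esum_(i in [set: Omega]) `|iter n (eapp KE) a i - v i| <= e%:E)%E.
  move=> [a0 af]; pose c := fine (\esum_(i in [set: Omega]) a i)%E / m.
  have afin : (\esum_(i in [set: Omega]) a i)%E \is a fin_num.
    by rewrite ge0_fin_numE// esum_ge0.
  have c0 : (0 <= c%:E)%E by rewrite lee_fin divr_ge0 ?fine_ge0 ?esum_ge0// ltW.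
  pose v i := (c%:E * pi i)%E.
  have v0 i : (0 <= v i)%E by rewrite mule_ge0.
  have v_mass : (\esum_(i in [set: Omega]) a i = \esum_(i in [set: Omega]) v i)%E.
    by rewrite esumZl// mE -EFinM divfK ?gt_eqF// fineK.
  have Kv n : iter n (eapp KE) v = v.
    by elim: n => //= n ->; rewrite eappZ// Kpi.
  exists v; first by split; rewrite -?v_mass.
  move=> e e0.
  have [N hN] := iter_eapp_merge KE0 K1 K_diag K_conn pi0 pio_gt0 pi_fin Kpi a0 v0 af v_mass e0.
  by exists N => n /hN; rewrite Kv.
pose p i := (X0^\+ i)%:E; pose q i := (X0^\- i)%:E.
have mp : finite_mass p.
  split=> [i|]; first by rewrite lee_fin.
  apply: le_lt_trans X0_l1; apply: le_esum => i _.
  by rewrite lee_fin /= ge_max normr_ge0 ler_norm.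
have mq : finite_mass q.
  split=> [i|]; first by rewrite lee_fin.
  apply: le_lt_trans X0_l1; apply: le_esum => i _.
  by rewrite lee_fin /= ge_max normr_ge0 -normrN ler_norm.
have [v mv pv] := limit_of p mp; have [w mw qw] := limit_of q mq.
have X0E : X0 = fun j => fine (p j) - fine (q j).
  by apply/funext => j /=; have /(congr1 (fun f => f j)) := funrposBneg X0; rewrite fctE.
have fin (a : Omega -> \bar R) i : finite_mass a -> (fine (a i))%:E = a i.
  by move=> ma; rewrite fineK//; exact: finite_mass_fin.
exists (fun i => fine (v i) - fine (w i)).
  have [v0 vf] := mv; have [w0 wf] := mw.
  have vw_fin := lte_add_pinfty vf wf.
  rewrite -(esumD (fun i _ => v0 i) (fun i _ => w0 i)) in vw_fin.
  apply: le_lt_trans vw_fin; apply: le_esum => i _.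
  rewrite -(fin v i mv) -(fin w i mw) -EFinD lee_fin /=.
  apply: le_trans (ler_normB _ _) _.
  by rewrite (ger0_norm (fine_ge0 (v0 i))) (ger0_norm (fine_ge0 (w0 i))).
have small := expapp_cvg K0 K1 lam0 mp mq mv mw pv qw.
rewrite -X0E -generator_uniformized// in small.
have norm_ge0 t : (0 <= l1norm (fun i => (expapp (generator g) t X0 i -
    (fine (v i) - fine (w i)))%R))%E.
  by apply: esum_ge0 => i _; rewrite lee_fin.
(* The norm is an extended real: eventual finiteness comes first, then convergence of its real
   value. *)
apply/fine_cvgP; split.
  have [t0 ht0] := small 1 ltr01.
  near=> t; rewrite ge0_fin_numE//; apply: le_lt_trans (ltry 1); apply: ht0.
  by near: t; apply: nbhs_pinfty_ge; exact: num_real.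
apply/cvgrPdist_le => e e0; have [t0 ht0] := small e e0.
near=> t; have le_e : (l1norm (fun i => (expapp (generator g) t X0 i -
    (fine (v i) - fine (w i)))%R) <= e%:E)%E.
  by apply: ht0; near: t; apply: nbhs_pinfty_ge; exact: num_real.
rewrite sub0r normrN /= ger0_norm ?fine_ge0// -lee_fin fineK//.
by rewrite ge0_fin_numE// (le_lt_trans le_e (ltry e)).
Unshelve. all: by end_near. Qed.
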